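(* Assume $t_0>0$, $\alpha>3$; $\xi:[t_0,+\infty)\to(0,+\infty)$ is a differentiable function for which there exist $t_1'\ge t_0$ and a (sufficiently small) constant $\delta>0$ such that $$\Big(2-\frac{2\alpha}{3}\Big)+t\,\frac{\dot\xi(t)}{\xi(t)}<-\delta\qquad\text{for all } t\ge t_1';$$ and $\epsilon$ is a continuously differentiable nonincreasing function such that there exist $M>1$ and $t_1'\ge t_0$ with $$2\dot\epsilon(t)+M\Big|\gamma+\frac{\beta}{t}\Big|\,\xi(t)\,\epsilon(t)^2\le 0\qquad\text{for all } t\ge t_1'.$$ Let $(x(t),\lambda(t))_{t\ge t_0}$ be any solution of the dynamical system (PDDS-IHDTR) described in the context and let $(x^*,\lambda^* )\in\Omega$ be any primal-dual optimal solution. Write $\beta(t)=\gamma+\frac{\beta}{t}$. Then: (i) If in addition $\int_{t_0}^{+\infty}t\,\xi(t)\epsilon(t)\,dt<+\infty$ and $\lim_{t\to+\infty}t^2\xi(t)=+\infty$, then $(x(\cdot),\lambda(\cdot))$ is bounded and there is $t_2\ge t_0$ such that $$\int_{t_2}^{+\infty} t\,\xi(t)\big(\mathcal{L}_\rho(x(t)+\beta(t)\dot x(t),\lambda^* )-\mathcal{L}_\rho(x^*,\lambda^* )\big)\,dt<+\infty,\qquad \int_{t_2}^{+\infty}t\,\xi(t)\epsilon(t)\|x(t)\|^2\,dt<+\infty,$$ $$\int_{t_2}^{+\infty} t\big(\|\dot x(t)\|^2+\|\dot\lambda(t)\|^2\big)\,dt<+\infty,\qquad \int_{t_2}^{+\infty}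 t\,\xi(t)\|A(x(t)+\beta(t)\dot x(t))-b\|^2\,dt<+\infty,$$ and, as $t\to+\infty$, $$\mathcal{L}_\rho(x(t)+\beta(t)\dot x(t),\lambda^* )-\mathcal{L}_\rho(x^*,\lambda^* )=\mathcal{O}\Big(\frac{1}{t^2\xi(t)}\Big),\qquad \|(\dot x(t),\dot\lambda(t))\|=\mathcal{O}\Big(\frac1t\Big),$$ $$\|A(x(t)+\beta(t)\dot x(t))-b\|=\mathcal{O}\Big(\frac{1}{t^2\xi(t)}\Big),\qquad |f(x(t)+\beta(t)\dot x(t))-f(x^* )|=\mathcal{O}\Big(\frac{1}{t^2\xi(t)}\Big).$$ (ii) If in addition (to the assumptions preceding (i)) $\int_{t_0}^{+\infty}\frac{\xi(t)\epsilon(t)}{t}\,dt<+\infty$, then $\lim_{t\to+\infty}(\dot x(t),\dot\lambda(t))=\mathbf{0}$.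
   Context: $\mathcal{X},\mathcal{Y}$ are real Hilbert spaces, $f:\mathcal{X}\to\mathbb{R}$ is convex and continuously differentiable, $A:\mathcal{X}\to\mathcal{Y}$ is a continuous linear operator with adjoint $A^T$, $b\in\mathcal{Y}$. The problem is $\min_{x\in\mathcal{X}} f(x)$ subject to $Ax=b$. The Lagrangian is $\mathcal{L}(x,\lambda)=f(x)+\langle\lambda,Ax-b\rangle$ and the augmented Lagrangian is $\mathcal{L}_\rho(x,\lambda)=\mathcal{L}(x,\lambda)+\frac{\rho}{2}\|Ax-b\|^2$ with a fixed $\rho>0$; thus $\nabla_x\mathcal{L}_\rho(x,\lambda)=\nabla f(x)+A^T\lambda+\rho A^T(Ax-b)$ and $\nabla_\lambda\mathcal{L}_\rho(x,\lambda)=Ax-b$. $\Omega$ is the set of saddle points of $\mathcal{L}$, i.e. the pairs $(x^*,\lambda^* )\in\mathcal{X}\times\mathcal{Y}$ with $\mathcal{L}(x^*,\lambda)\le\mathcal{L}(x^*,\lambda^* )\le\mathcal{L}(x,\lambda^* )$ for all $(x,\lambda)$; elements of $\Omega$ are called primal-dual optimal solutions. It is assumed that $\Omega\ne\emptyset$. On $\mathcal{X}\times\mathcal{Y}$ the product norm is used. Dynamical system (PDDS-IHDTR), for $t\ge t_0>0$ and $\alpha>0$: $$\ddot x(t)+\frac{\alpha}{t}\dot x(t)+\xi(t)\big(\nabla_x\mathcal{L}_\rho(\hat x(t),\bar\lambda(t))+\epsilon(t)x(t)\big)=0,$$ $$\ddot\lambda(t)+\frac{\alpha}{t}\dot\lambda(t)-\xi(t)\Big(\nabla_\lambda\mathcal{L}_\rho(\bar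 x(t),\lambda(t))+\eta(t)A\dot x(t)-\frac{3}{2\alpha}t\,\xi(t)\beta(t)\,A\big(\nabla_x\mathcal{L}_\rho(\hat x(t),\bar\lambda(t))+\epsilon(t)x(t)\big)\Big)=0,$$ where $\beta(t)=\gamma+\frac{\beta}{t}$ with constants satisfying either $\gamma>0,\ \beta\in\mathbb{R}$, or $\gamma=0,\ \beta\ge0$; $\hat x(t)=x(t)+\beta(t)\dot x(t)$; $\bar x(t)=x(t)+\frac{3}{2\alpha}t\dot x(t)$; $\bar\lambda(t)=\lambda(t)+\frac{3}{2\alpha}t\dot\lambda(t)$; $\eta(t)=\frac{1}{2\alpha}(-\alpha\beta(t)+3t\dot\beta(t))$; $\xi:[t_0,+\infty)\to(0,+\infty)$ is continuous; and $\epsilon:[t_0,+\infty)\to\mathbb{R}_+=[0,+\infty)$ is a $\mathcal{C}^1$ nonincreasing function with $\lim_{t\to+\infty}\epsilon(t)=0$. A solution is a pair of twice differentiable functions $x:[t_0,+\infty)\to\mathcal{X}$, $\lambda:[t_0,+\infty)\to\mathcal{Y}$ satisfying both equations for all $t\ge t_0$. *)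

(* Defs.v *)
From HB Require Import structures.
From mathcomp Require Import all_boot all_order all_algebra.
From mathcomp Require Import all_classical all_reals all_analysis.

Set Implicit Arguments.
Unset Strict Implicit.
Unset Printing Implicit Defensive.

Import Order.TTheory GRing.Theory Num.Theory.
Import numFieldNormedType.Exports.

Local Open Scope classical_set_scope.
Local Open Scope ring_scope.

HB.mixin Record isHilbert (R : realType) X of CompleteNormedModule R X := {
  inner : {dot X for (@idfun R)} ;
  inner_normE : forall x : X, inner x x = `|x| ^+ 2
}.

#[short(type="hilbertType")]
HB.structure Definition Hilbert (R : realType) :=
  {X of isHilbert R X & CompleteNormedModule R X}.

(* In MathComp-Analysis the norm of [X * Y] is the maximum of the two norms;
   the norm below is the Hilbert norm of the product. *)
Definition prod_norm (R : realType) (X Y : hilbertType R) (x : X) (y : Y) : R :=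
  Num.sqrt (`|x| ^+ 2 + `|y| ^+ 2).

(* Lets the library notation [f =O_F g] be used with F = pinfty_nbhs R. *)
Canonical pinfty_filter_on (R : numFieldType) : filter_on R :=
  FilterType (pinfty_nbhs R) _.

(* Functions on [t0, +oo[ are represented by total functions on R of which only
   the values on [t0, +oo[ matter. Accordingly the increments are restricted to
   those that stay in [t0, +oo[: the derivative is the usual one at t > t0 and
   the right derivative at t0. *)
Definition increments_from (R : realType) (t0 t : R) : set_system R :=
  within [set h | t0 <= h + t] 0^'.

Definition derivable_from (R : realType) (V : normedModType R) (t0 : R)
    (u : R -> V) : Prop :=
  forall t, t0 <= t ->
    cvg (h^-1 *: (u (h + t) - u t) @[h --> increments_from t0 t]).

Definition derive_from (R : realType) (V : normedModType R) (t0 : R)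
    (u : R -> V) (t : R) : V :=
  lim (h^-1 *: (u (h + t) - u t) @[h --> increments_from t0 t]).

Definition twice_derivable_from (R : realType) (V : normedModType R) (t0 : R)
    (u : R -> V) : Prop :=
  derivable_from t0 u /\ derivable_from t0 (derive_from t0 u).

Definition C1_from (R : realType) (V : normedModType R) (t0 : R)
    (u : R -> V) : Prop :=
  derivable_from t0 u /\ {within `[t0, +oo[, continuous (derive_from t0 u)}.

Lemma increments_fromE (R : realType) (t0 t : R) : t0 < t ->
  increments_from t0 t = 0^'.
Proof.
move=> t0t; apply/seteqP; split => B; last exact: cvg_within.
rewrite /increments_from /within /= => wB.
have t0ht : \forall h \near (0 : R)^', t0 <= h + t.
  apply: nbhs_dnbhs; near=> h; rewrite -lerBlDr ltW//.
  by near: h; apply: lt_nbhsr; rewrite subr_lt0.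
by apply: filterS2 wB t0ht => h; apply.
Unshelve. all: by end_near. Qed.

Lemma derive_fromE (R : realType) (V : normedModType R) (t0 : R)
    (u : R -> V) (t : R) : t0 < t -> derive_from t0 u t = derive1 u t.
Proof. by move=> t0t; rewrite /derive_from increments_fromE. Qed.

Definition lagrangian (R : realType) (X Y : hilbertType R) (f : X -> R)
    (A : X -> Y) (b : Y) (x : X) (l : Y) : R :=
  f x + inner l (A x - b).

Definition saddle_points (R : realType) (X Y : hilbertType R) (f : X -> R)
    (A : X -> Y) (b : Y) : set (X * Y) :=
  [set z | forall x l,
    lagrangian f A b z.1 l <= lagrangian f A b z.1 z.2 /\
    lagrangian f A b z.1 z.2 <= lagrangian f A b x z.2].

Definition aug_lagrangian (R : realType) (X Y : hilbertType R) (rho : R)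
    (f : X -> R) (A : X -> Y) (b : Y) (x : X) (l : Y) : R :=
  lagrangian f A b x l + rho / 2 * `|A x - b| ^+ 2.

(* By the Riesz representation theorem a differentiable f has exactly one
   gradient map, and a continuous linear A exactly one adjoint; they are given
   here by the properties that characterize them. The gradient map is continuous
   if and only if f is continuously differentiable. *)
Definition is_gradient (R : realType) (X : hilbertType R) (f : X -> R)
    (g : X -> X) : Prop :=
  forall x, differentiable f x /\ forall v, 'd f x v = inner (g x) v.

Definition is_adjoint (R : realType) (X Y : hilbertType R) (A : X -> Y)
    (AT : Y -> X) : Prop :=
  forall x y, inner (A x) y = inner x (AT y).

(* The partial gradients of the augmented Lagrangian: with gradf the gradient of
   f and AT the adjoint of A, the gradient of L_rho(., l) at x is
   gradf x + A^T l + rho A^T (A x - b), and that of L_rho(x, .) is A x - b,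
   which does not depend on l. *)
Definition aug_gradx (R : realType) (X Y : hilbertType R) (rho : R)
    (gradf : X -> X) (A : X -> Y) (AT : Y -> X) (b : Y) (x : X) (l : Y) : X :=
  gradf x + AT l + rho *: AT (A x - b).

Definition aug_gradl (R : realType) (X Y : hilbertType R)
    (A : X -> Y) (b : Y) (x : X) (l : Y) : Y :=
  A x - b.

Definition betaf (R : realType) (gamma beta t : R) : R := gamma + beta / t.

Definition etaf (R : realType) (t0 alpha gamma beta t : R) : R :=
  (2 * alpha)^-1 * (- alpha * betaf gamma beta t
                    + 3 * t * derive_from t0 (betaf gamma beta) t).

Definition hat (R : realType) (V : normedModType R) (t0 gamma beta : R)
    (u : R -> V) (t : R) : V :=
  u t + betaf gamma beta t *: derive_from t0 u t.

Definition bar (R : realType) (V : normedModType R) (t0 alpha : R)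
    (u : R -> V) (t : R) : V :=
  u t + (3 / (2 * alpha) * t) *: derive_from t0 u t.

(* The term \nabla_x L_rho(\hat x(t), \bar\lambda(t)) + eps(t) x(t). *)
Definition tikhonov_gradx (R : realType) (X Y : hilbertType R)
    (rho alpha gamma beta t0 : R) (gradf : X -> X) (A : X -> Y) (AT : Y -> X)
    (b : Y) (eps : R -> R) (x : R -> X) (l : R -> Y) (t : R) : X :=
  aug_gradx rho gradf A AT b (hat t0 gamma beta x t) (bar t0 alpha l t)
  + eps t *: x t.

Definition solution (R : realType) (X Y : hilbertType R)
    (rho alpha gamma beta t0 : R) (gradf : X -> X) (A : X -> Y) (AT : Y -> X)
    (b : Y) (xi eps : R -> R) (x : R -> X) (l : R -> Y) : Prop :=
  let G := tikhonov_gradx rho alpha gamma beta t0 gradf A AT b eps x l in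
  let D V := @derive_from R V t0 in
  [/\ twice_derivable_from t0 x,
      twice_derivable_from t0 l &
      forall t, t0 <= t ->
        D X (D X x) t + (alpha / t) *: D X x t + xi t *: G t = 0 /\
        D Y (D Y l) t + (alpha / t) *: D Y l t
        - xi t *: (aug_gradl A b (bar t0 alpha x t) (l t)
                   + etaf t0 alpha gamma beta t *: A (D X x t)
                   - (3 / (2 * alpha) * t * xi t * betaf gamma beta t)
                       *: A (G t)) = 0].

(* Main.v *)
(* Put sigma = 2 alpha / 3 > 2, y = xhat, G = grad_x L_rho(xhat, lbar) + eps x,
   v = sigma (x - x* ) + t x' and w = sigma (l - l* ) + t l'.  The Lyapunov
   function is
     E = (|v|^2 + |w|^2) / 2 + (sigma / 2 - 1) sigma / 2 (|x - x*|^2 + |l - l*|^2)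
         + t^2 xi (L_rho(y, l* ) - L_rho(x*, l* ) + eps / 2 |x|^2).
   The first equation gives t y' = v - sigma (y - x* ) + S with
   S = sigma eta x' - t xi beta G, and the second one
   w' = (1 - sigma / 2) l' + (t xi / sigma) A (v + S); hence in E' all products of
   w with A (.) combine with those of grad L_rho(y, l* ) into t xi <G - eps x, S>.
   This term is controlled by its own part - t^2 xi^2 beta |G|^2 and, thanks to
   M > 1, by t^2 xi eps' |x|^2 / 2, up to a multiple of beta |x'|^2 that is
   negligible with respect to t |x'|^2.  Convexity and the growth condition on xi
   then make E' at most sigma / 2 |x*|^2 t xi eps minus a positive multiple of
   all the quantities to be integrated.
   For the feasibility rate, z = A y - b satisfies t l'' + alpha l' =
   t xi (z + t z' / sigma), so that h = t^2 xi z solves h' + a h = F' with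
   a >= 0 and F = sigma (t l' + (alpha - 1) l) bounded; hence h is bounded.
   If only xi eps / t is integrable, integrating E' still gives E = o(t^2). *)

Require Import Defs.
From mathcomp Require Import all_boot all_order all_algebra.
From mathcomp Require Import all_classical all_reals all_analysis.
From mathcomp Require Import measurable_realfun.
From mathcomp Require Import ring lra.
Import Order.TTheory GRing.Theory Num.Theory.
Import numFieldNormedType.Exports.
Local Open Scope classical_set_scope.
Local Open Scope ring_scope.

Set Implicit Arguments.
Unset Strict Implicit.
Unset Printing Implicit Defensive.

(** * Inner product calculus in a real Hilbert space *)

Section inner_theory.
Context {R : realType} {X : hilbertType R}.
Implicit Types (x y z : X) (k : R).

Lemma innerC x y : inner x y = inner y x.
Proof. by rewrite [LHS]hermC expr0 mul1r. Qed.

Lemma innerDr x y z : inner x (y + z) = inner x y + inner x z.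
Proof. exact: linearDr. Qed.

Lemma innerZr k x y : inner x (k *: y) = k * inner x y.
Proof. exact: linearZr_LR. Qed.

Lemma innerDl x y z : inner (x + y) z = inner x z + inner y z.
Proof. by rewrite ![inner _ z]innerC innerDr. Qed.

Lemma innerZl k x y : inner (k *: x) y = k * inner x y.
Proof. by rewrite ![inner _ y]innerC innerZr. Qed.

Lemma innerNr x y : inner x (- y) = - inner x y.
Proof. by rewrite -scaleN1r innerZr mulN1r. Qed.

Lemma innerNl x y : inner (- x) y = - inner x y.
Proof. by rewrite -scaleN1r innerZl mulN1r. Qed.

Lemma inner0r x : inner x 0 = 0.
Proof. by have := innerZr 0 x 0; rewrite scale0r mul0r. Qed.

Lemma inner0l x : inner 0 x = 0.
Proof. by rewrite innerC inner0r. Qed.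

Definition innerE := (innerDl, innerDr, innerNl, innerNr, innerZl, innerZr).

Lemma inner_ge0 x : 0 <= inner x x.
Proof. by rewrite inner_normE sqr_ge0. Qed.

(** Testing against an arbitrary vector turns an identity between vectors into a scalar one, within
    reach of [ring] and [field]; most vector equations below are settled this way. *)
Lemma inner_inj x y : (forall z, inner z x = inner z y) -> x = y.
Proof.
move=> xy; apply/eqP; rewrite -subr_eq0 -normr_eq0 -sqrf_eq0 -inner_normE.
by rewrite innerDr innerNr xy subrr.
Qed.

(** Cauchy-Schwarz: the squared norm of [inner x x *: y - inner x y *: x] is nonnegative and has the
    positive factor [inner x x], which cancels. *)
Lemma normr_inner x y : `|inner x y| <= `|x| * `|y|.
Proof.
have [->|x0] := eqVneq x 0; first by rewrite inner0l !normr0 mul0r.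
rewrite -ler_sqr ?nnegrE ?mulr_ge0// exprMn real_normK ?num_real//.
have xx0 : 0 < inner x x by rewrite inner_normE exprn_gt0 ?normr_gt0.
have := inner_ge0 (inner x x *: y - inner x y *: x).
rewrite -!inner_normE !innerE (innerC y x).
set a := inner x x in xx0 *; set c := inner x y; set d := inner y y => H.
have {H} : 0 <= a * (a * d - c ^+ 2) by move: H; congr (_ <= _); ring.
by rewrite pmulr_rge0// subr_ge0.
Qed.

(** Polarization reduces the continuity of the inner product to that of the norm. *)
Lemma inner_polar x y : inner x y = 4^-1 * (`|x + y| ^+ 2 - `|x - y| ^+ 2).
Proof. by rewrite -!inner_normE !innerE (innerC y x); field. Qed.

Lemma cvg_inner {T : Type} {F : set_system T} {FF : Filter F}
    (u v : T -> X) (a b : X) :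
  u @ F --> a -> v @ F --> b -> inner (u t) (v t) @[t --> F] --> inner a b.
Proof.
move=> ua vb; rewrite inner_polar.
under eq_fun do rewrite inner_polar !expr2.
apply: cvgMr; rewrite !expr2; apply: cvgB; apply: cvgM; apply: cvg_norm;
  by [apply: cvgD|apply: cvgB].
Qed.

End inner_theory.

(** * Differentiation rules along curves *)

Section derive_rules.
Context {R : realType}.
Implicit Types (t : R).

(** Puts [is_derive] in terms of the difference quotient that defines [derive_from], so that the two
    notions can be exchanged at interior times. *)
Lemma is_derive1P {V : normedModType R} (u : R -> V) t du :
  is_derive t 1 u du <-> h^-1 *: (u (h + t) - u t) @[h --> 0^'] --> du.
Proof.
have E : (fun h => h^-1 *: ((u \o shift t) (h *: 1) - u t)) =
         (fun h => h^-1 *: (u (h + t) - u t)).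
  by apply/funext => h; rewrite /= [h *: 1]mulr1.
split=> [[+ <-]|H].
  by rewrite /derivable /derive E.
apply: DeriveDef; first by rewrite /derivable E; apply/cvg_ex; exists du.
by rewrite /derive E; apply/cvg_lim => //; exact: norm_hausdorff.
Qed.

Lemma is_derive_continuous {V : normedModType R} (u : R -> V) t du :
  is_derive t 1 u du -> {for t, continuous u}.
Proof.
by move=> [/derivable1_diffP/differentiable_continuous].
Qed.

Lemma is_derive_cvg {V : normedModType R} (u : R -> V) t du :
  is_derive t 1 u du -> u (h + t) @[h --> 0^'] --> u t.
Proof.
move=> /is_derive_continuous uc.
apply: (@cvg_comp _ _ _ (fun h => h + t) u _ (nbhs t)) => //.
apply: cvg_trans (_ : (fun h => h + t) @ nbhs (0 : R) --> t).
  by apply: cvg_app; exact: nbhs_dnbhs.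
rewrite -[X in _ --> X]add0r; apply: cvgD; [exact: cvg_id|exact: cvg_cst].
Qed.

Lemma is_derive_inner {X : hilbertType R} (u v : R -> X) t du dv :
  is_derive t 1 u du -> is_derive t 1 v dv ->
  is_derive t 1 (fun s => inner (u s) (v s)) (inner du (v t) + inner (u t) dv).
Proof.
move=> Du Dv; apply/is_derive1P.
rewrite (_ : (fun _ => _) = fun h =>
    inner (h^-1 *: (u (h + t) - u t)) (v (h + t)) +
    inner (u t) (h^-1 *: (v (h + t) - v t))); last first.
  by apply/funext => h /=; rewrite !innerE [_ *: _ in LHS]/GRing.scale/=; ring.
apply: cvgD; apply: cvg_inner.
- exact/is_derive1P.
- exact: is_derive_cvg Dv.
- exact: cvg_cst.
- exact/is_derive1P.
Qed.

Lemma is_deriveZfun {V : normedModType R} (k : R -> R) (u : R -> V) t dk du :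
  is_derive t 1 k dk -> is_derive t 1 u du ->
  is_derive t 1 (fun s => k s *: u s) (dk *: u t + k t *: du).
Proof.
move=> Dk Du; apply/is_derive1P.
rewrite (_ : (fun _ => _) = fun h =>
    (h^-1 *: (k (h + t) - k t)) *: u (h + t) +
    k t *: (h^-1 *: (u (h + t) - u t))); last first.
  apply/funext => h /=.
  rewrite [h^-1 *: (k _ - _)]/GRing.scale/= scalerA [k t * _]mulrC -!scalerA.
  by rewrite -scalerDr scalerBl [k t *: (_ - _)]scalerBr addrA subrK.
apply: cvgD; apply: cvgZ.
- exact/is_derive1P.
- exact: is_derive_cvg Du.
- exact: cvg_cst.
- exact/is_derive1P.
Qed.

(** The pointwise form lets nested rules assemble the derivative of a long expression by plain
    application. *)
Lemma is_deriveDfun {V : normedModType R} (u v : R -> V) t du dv :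
  is_derive t 1 u du -> is_derive t 1 v dv ->
  is_derive t 1 (fun s => u s + v s) (du + dv).
Proof. exact: is_deriveD. Qed.

Lemma is_deriveBcst {V : normedModType R} (u : R -> V) (c : V) t du :
  is_derive t 1 u du -> is_derive t 1 (fun s => u s - c) du.
Proof.
move=> Du; have D := is_deriveB Du (is_derive_cst c t 1).
by apply: (is_derive_eq D); rewrite subr0.
Qed.

Lemma is_deriveMfun (f g : R -> R) t df dg :
  is_derive t 1 f df -> is_derive t 1 g dg ->
  is_derive t 1 (fun s => f s * g s) (df * g t + f t * dg).
Proof.
move=> Df Dg; apply: (is_derive_eq (is_deriveM Df Dg)).
by rewrite addrC [g t *: _]mulrC.
Qed.

Lemma is_derive_linear {V W : normedModType R} (A : {linear V -> W})
    (u : R -> V) t du :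
  continuous A -> is_derive t 1 u du ->
  is_derive t 1 (fun s => A (u s)) (A du).
Proof.
move=> cA Du; apply/is_derive1P.
rewrite (_ : (fun _ => _) = fun h => A (h^-1 *: (u (h + t) - u t))); last first.
  by apply/funext => h; rewrite [RHS]linearZ/= [in RHS]linearB.
move/is_derive1P in Du.
exact: cvg_comp Du (cA du).
Qed.

Lemma is_derive_diff_comp {V W : normedModType R} (f : V -> W)
    (u : R -> V) t du :
  differentiable f (u t) -> is_derive t 1 u du ->
  is_derive t 1 (fun s => f (u s)) ('d f (u t) du).
Proof.
move=> Df [/derivable1_diffP Du <-].
have Dfu : differentiable (f \o u) t by exact: differentiable_comp.
apply: DeriveDef; first exact/derivable1_diffP.
by rewrite !deriveE// diff_comp.
Qed.

End derive_rules.

(** * Monotonicity, continuity and improper integrals on a half-line *)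

Section halfline.
Context {R : realType}.
Implicit Types (a s t : R) (F dF p : R -> R).

Lemma is_derive_le0_le F dF s t : s <= t ->
  (forall u, s <= u <= t -> is_derive u 1 F (dF u)) ->
  (forall u, s <= u <= t -> dF u <= 0) -> F t <= F s.
Proof.
move=> st DF dF0; apply: (@ler0_derive1_nincr R F s t) => //.
- move=> u; rewrite in_itv/= => /andP[su ut].
  by have [] := DF u; rewrite ?(ltW su) ?(ltW ut).
- move=> u; rewrite in_itv/= => /andP[/ltW su /ltW ut].
  have sut : s <= u <= t by rewrite su.
  by have [_ E] := DF u sut; rewrite derive1E E dF0.
- apply: derivable_within_continuous => u; rewrite in_itv/= => sut.
  by have [] := DF u sut.
Qed.

Lemma is_derive_le0_nonincreasing F dF a :
  (forall t, a <= t -> is_derive t 1 F (dF t)) ->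
  (forall t, a <= t -> dF t <= 0) ->
  forall s t, a <= s -> s <= t -> F t <= F s.
Proof.
move=> DF dF0 s t as_ st.
apply: (is_derive_le0_le (dF := dF)) => // u /andP[su _].
  exact/DF/(le_trans as_ su).
exact/dF0/(le_trans as_ su).
Qed.

Lemma halfline_continuous_within {V : normedModType R} (u : R -> V) a :
  (forall t, a <= t -> {for t, continuous u}) ->
  {within `[a, +oo[, continuous u}.
Proof.
move=> cu; apply/continuous_within_itvcyP; split.
  by move=> t; rewrite in_itv/= andbT => /ltW; exact: cu.
exact/cvg_at_right_filter/cu.
Qed.

Lemma within_continuousM (D : set R) (p q : R -> R) :
  {within D, continuous p} -> {within D, continuous q} ->
  {within D, continuous (fun s => p s * q s)}.
Proof. by move=> cp cq s; apply: cvgM; [exact: cp|exact: cq]. Qed.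

Lemma within_halfline_continuous {V : normedModType R} (u : R -> V) a t :
  {within `[a, +oo[, continuous u} -> a < t -> {for t, continuous u}.
Proof.
by move=> /continuous_within_itvcyP[+ _] at_; apply; rewrite in_itv/= at_.
Qed.

Lemma derivable_from_is_derive {V : normedModType R} (u : R -> V) t0 t :
  derivable_from t0 u -> t0 < t -> is_derive t 1 u (derive_from t0 u t).
Proof.
move=> /(_ t) Du t0t; apply/is_derive1P.
have := Du (ltW t0t).
by rewrite increments_fromE// derive_fromE// /derive1.
Qed.

(** Only the end point [t0] needs care: there u(s) = (s - t0) q(s) + u(t0), where the quotient q
    converges to the right derivative. *)
Lemma derivable_from_within_continuous {V : normedModType R} (u : R -> V) t0 :
  derivable_from t0 u -> {within `[t0, +oo[, continuous u}.
Proof.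
move=> Du; apply/continuous_within_itvcyP; split.
  move=> t; rewrite in_itv/= andbT => t0t.
  exact: is_derive_continuous (derivable_from_is_derive Du t0t).
have /cvg_ex[d dP] := Du t0 (lexx _).
have shift0 : s - t0 @[s --> t0^'+] --> increments_from t0 t0.
  move=> B; rewrite /increments_from /within /= => -[e /= e0 eB].
  exists e => //= s /= se t0s; apply: eB => /=; last by rewrite subrK ltW.
    by rewrite sub0r opprB.
  by rewrite subr_eq0 gt_eqF.
have s0 : s - t0 @[s --> t0^'+] --> (0 : R).
  apply: cvg_at_right_filter.
  by rewrite -[X in _ --> X](subrr t0); apply: cvgB; [exact: cvg_id|exact: cvg_cst].
rewrite -[X in _ --> X]add0r -[X in X + _](scale0r d).
pose q s := (s - t0)^-1 *: (u (s - t0 + t0) - u t0).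
apply: cvg_trans (_ : (fun s => (s - t0) *: q s + u t0) @ t0^'+ --> _).
  apply: near_eq_cvg; apply: filterS (nbhs_right_gt t0) => s t0s.
  by rewrite /q scalerA divff ?scale1r ?subrK// subr_eq0 gt_eqF.
apply: cvgD; last exact: cvg_cst.
by apply: cvgZ => //; exact: cvg_comp shift0 dP.
Qed.

Lemma primitive_is_derive p a t : {within `[a, +oo[, continuous p} -> a < t ->
  is_derive t 1 (fun s => \int[lebesgue_measure]_(r in `[a, s]) p r) (p t).
Proof.
move=> cp at_.
(* The right end [t + 1] makes [t] an interior point of the interval. *)
have [|||D <-] := @continuous_FTC1_closed R p a t (t + 1) _ _ at_.
- by rewrite ltrDl.
- apply: continuous_compact_integrable; first exact: segment_compact.
  by apply: continuous_subspaceW cp => s /=; rewrite !in_itv/= => /andP[->].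
- exact: within_halfline_continuous cp at_.
- by rewrite derive1E; exact/derivableP.
Qed.

(** Turns an integrability hypothesis into a bounded primitive, the form in which it can be
    subtracted from the energy. The derivative is claimed for [a < t] because the primitive is
    two-sided differentiable only there. *)
Lemma bounded_primitive p a : {within `[a, +oo[, continuous p} ->
  (forall t, a <= t -> 0 <= p t) ->
  (\int[lebesgue_measure]_(t in `[a, +oo[) (p t)%:E < +oo)%E ->
  exists P K, forall t, a < t -> is_derive t 1 P (p t) /\ 0 <= P t <= K.
Proof.
move=> cp p0 pfin; pose mu := @lebesgue_measure R.
exists (fun t => \int[mu]_(r in `[a, t]) p r).
exists (fine (\int[mu]_(t in `[a, +oo[) (p t)%:E)) => t at_.
split; first exact: primitive_is_derive.
have mp : measurable_fun `[a, +oo[ p by exact: subspace_continuous_measurable_fun.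
have p0E s : `[a, +oo[%classic s -> (0 <= (p s)%:E)%E.
  by rewrite /= in_itv/= andbT lee_fin => /p0.
have sub : `[a, t] `<=` `[a, +oo[ by move=> s /=; rewrite !in_itv/= => /andP[->].
have fi : mu.-integrable `[a, +oo[ (EFin \o p).
  apply/integrableP; split; first exact/measurable_EFinP.
  under eq_integral => s /[!inE] sa do rewrite gee0_abs ?p0E//.
  exact: pfin.
rewrite fine_ge0/=; last by apply: integral_ge0 => s /sub/p0E.
apply: fine_le.
- by apply: integrable_fin_num => //; exact: integrableS fi.
- exact: integrable_fin_num.
- by apply: ge0_subset_integral => //; exact/measurable_EFinP.
Qed.

(** The primitive of [p] from [a] minus [F] is nonincreasing, so each integral over [a, a + n] is at
    most [K - F a]; monotone convergence then reaches the half-line. *)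
Lemma dominated_integral_lt_pinfty p F dF a K :
  {within `[a, +oo[, continuous p} -> (forall t, a <= t -> 0 <= p t) ->
  (forall t, a <= t -> is_derive t 1 F (dF t)) ->
  (forall t, a <= t -> p t <= dF t) -> (forall t, a <= t -> F t <= K) ->
  (\int[lebesgue_measure]_(t in `[a, +oo[) (p t)%:E < +oo)%E.
Proof.
move=> cp p0 DF pF FK; pose mu := @lebesgue_measure R.
have mp : measurable_fun `[a, +oo[ p by exact: subspace_continuous_measurable_fun.
have subn (n : nat) : `[a, a + n%:R] `<=` `[a, +oo[.
  by move=> s /=; rewrite !in_itv/= => /andP[->].
have bound (n : nat) :
    (\int[mu]_(t in `[a, (a + n%:R)%R]) (p t)%:E <= (K - F a)%:E)%E.
  have an : a <= a + n%:R by rewrite lerDl.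
  have cpn : {within `[a, a + n%:R], continuous p}.
    exact: continuous_subspaceW (subn n) cp.
  have ip : mu.-integrable `[a, a + n%:R] (EFin \o p).
    by apply: continuous_compact_integrable => //; exact: segment_compact.
  rewrite -[leLHS]fineK; last exact: integrable_fin_num.
  rewrite lee_fin.
  pose H t := \int[mu]_(r in `[a, t]) p r.
  have H0 : H a = 0 by rewrite /H set_itv1 Rintegral_set1.
  suff : H (a + n%:R) - F (a + n%:R) <= H a - F a.
    by rewrite H0 sub0r lerBlDr => /le_trans; apply; rewrite addrC lerD2r FK.
  apply: (@ler0_derive1_nincr R (fun t => H t - F t) a (a + n%:R)) => //.
  - move=> u; rewrite in_itv/= => /andP[au _].
    have Hu := primitive_is_derive cp au; have Fu := DF u (ltW au).
    by have [] := is_deriveB Hu Fu.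
  - move=> u; rewrite in_itv/= => /andP[au _].
    have Hu := primitive_is_derive cp au; have Fu := DF u (ltW au).
    have [_ +] := is_deriveB Hu Fu; rewrite derive1E => ->.
    by rewrite subr_le0 pF// ltW.
  - have cF : {within `[a, a + n%:R], continuous F}.
      apply: derivable_within_continuous => u; rewrite in_itv/= => /andP[au _].
      by have [] := DF u au.
    have cH := parameterized_integral_continuous an ip.
    by move=> u; apply: cvgB; [exact: cH|exact: cF].
apply: (@le_lt_trans _ _ (K - F a)%:E); last exact: ltry.
rewrite itv_bndy_bigcup_BRight.
have cvgI : (\int[mu]_(t in `[a, (a + n%:R)%R]) (p t)%:E @[n --> \oo] -->
    \int[mu]_(t in \bigcup_n `[a, (a + n%:R)%R]%classic) (p t)%:E)%E.
  apply: ge0_nondecreasing_set_cvg_integral => //.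
  - move=> m n mn; apply/subsetPset => s /=.
    rewrite !in_itv/= => /andP[-> /=] /le_trans; apply.
    by rewrite lerD2l ler_nat.
  - by move=> n; apply/measurable_EFinP; exact: measurable_funS (subn n) mp.
  - by move=> n s /=; rewrite in_itv/= lee_fin => /andP[/p0].
by apply: (cvge_to_le cvgI); near=> n; exact: bound.
Unshelve. all: by end_near. Qed.

End halfline.

(** * Algebraic identities and convexity estimates at a fixed time *)

Section pointwise.
Context {R : realType} {X Y : hilbertType R}.

(* [P] stands for [AT lbar - AT ls]: as [AT] is only known to be adjoint to [A],
   it enters through its inner products, which replaces its linearity. *)
Lemma energy_rate_identity (A : {linear X -> Y}) (x xs q g G P v y dv dy S : X)
    (l ls r w dw : Y) (t xi eps beta sigma c : R) :
  t != 0 -> sigma != 0 ->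
  v = sigma *: (x - xs) + t *: q ->
  w = sigma *: (l - ls) + t *: r ->
  y = x + beta *: q ->
  S = c *: q - (t * xi * beta) *: G ->
  dv = (1 - sigma / 2) *: q - (t * xi) *: G ->
  dw = (1 - sigma / 2) *: r + (t * xi / sigma) *: (A v + A S) ->
  t *: dy = t *: q - (sigma * beta) *: q + S ->
  G = g + P + eps *: x ->
  (forall u, inner P u = sigma^-1 * inner w (A u)) ->
  inner v dv + inner w dw
    + (sigma / 2 - 1) * sigma * (inner (x - xs) q + inner (l - ls) r)
    + t ^+ 2 * xi * inner g dy + t ^+ 2 * xi * eps * inner x q
  = - (sigma / 2 - 1) * t * (inner q q + inner r r)
    + inner ((t * xi) *: G - (t * xi * eps) *: x) (c *: q - beta *: ((t * xi) *: G))
    - t * xi * sigma * inner g (y - xs)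
    - t * xi * sigma * eps * inner x (x - xs).
Proof.
move=> t0 s0 vE wE yE SE dvE dwE tdy GE PE.
have Pw u : inner w (A u) = sigma * inner P u by rewrite PE mulrA divff// mul1r.
have gE : g = G - P - eps *: x by apply/eqP; rewrite eq_sym !subr_eq addrAC GE.
have dyE : dy = t^-1 *: (t *: q - (sigma * beta) *: q + S).
  by rewrite -tdy scalerA mulVf// scale1r.
have wdw : inner w dw = (1 - sigma / 2) * inner w r + t * xi * (inner P v + inner P S).
  by rewrite dwE !innerE !Pw; field.
rewrite wdw wE dyE gE dvE SE yE vE.
rewrite !innerE.
(* Fixing the order of the arguments leaves one atom per pair of vectors, so that [field] can close
   the identity. *)
rewrite ?(innerC xs x) ?(innerC q x) ?(innerC G x) ?(innerC P x) ?(innerC q xs).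
rewrite ?(innerC G xs) ?(innerC P xs) ?(innerC G q) ?(innerC P q) ?(innerC P G).
by field; rewrite ?t0 ?s0.
Qed.

(* The slack is [|a - e / 2 - C / 2 q|^2] and
   [(M - 1) / 4 |e - C / (M - 1) q|^2], up to Cauchy-Schwarz. *)
Lemma dissipation_le (a e q : X) (beta c C M : R) :
  0 <= beta -> `|c| <= C * beta -> 1 < M ->
  inner (a - e) (c *: q - beta *: a) <=
  beta * (M / 4 * inner e e + C ^+ 2 / 4 * (1 + (M - 1)^-1) * inner q q).
Proof.
move=> b0 cC M1.
have M0 : 0 < M - 1 by rewrite subr_gt0.
have [d aE] : exists d, a = d + 2^-1 *: e.
  by exists (a - 2^-1 *: e); rewrite subrK.
have cle (u : X) : c * inner u q <= beta * (C * (`|u| * `|q|)).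
  apply: (le_trans (ler_norm _)); rewrite normrM mulrA [beta * C]mulrC.
  by apply: ler_pM => //; exact: normr_inner.
have := cle d; have := cle (- (2^-1 *: e)); rewrite normrN normrZ ger0_norm ?invr_ge0//.
rewrite aE.
have [nd ne nq] := And3 (inner_normE d) (inner_normE e) (inner_normE q).
rewrite !innerE. rewrite (innerC e d) nd ne nq.
set D := `|d|; set EE := `|e|; set Q := `|q| => h1 h2.
have h3 : 0 <= beta * (D - C / 2 * Q) ^+ 2 by rewrite mulr_ge0// sqr_ge0.
have h4 : 0 <= beta * ((M - 1) / 4 * (EE - C / (M - 1) * Q) ^+ 2).
  by rewrite mulr_ge0// mulr_ge0 ?sqr_ge0// divr_ge0// ltW.
have h5 : beta * ((M - 1) / 4 * (EE - C / (M - 1) * Q) ^+ 2) =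
  beta * ((M - 1) / 4 * EE ^+ 2 - C / 2 * EE * Q
          + C ^+ 2 / 4 * (M - 1)^-1 * Q ^+ 2).
  by field; rewrite gt_eqF.
rewrite h5 in h4.
set Mi := (M - 1)^-1 in h4 *.
lra.
Qed.

(** Along the segment from [y] to [x] the difference quotients of [f] with step 0 < h <= 1 are at
    most f(x) - f(y), and they tend to the directional derivative at [y]. *)
Lemma convex_gradient_le (f : X -> R) (gradf : X -> X) (x y : X) :
  convex_function [set: X] f -> is_gradient f gradf ->
  f y + inner (gradf y) (x - y) <= f x.
Proof.
move=> cf gf; rewrite addrC -lerBrDr.
have [df dfE] := gf y.
have Du : is_derive (0 : R) (1 : R) (fun s : R => s *: (x - y) + y) (x - y).
  have := is_deriveDfun (is_deriveZfun (is_derive_id (0 : R) 1)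
    (is_derive_cst (x - y) (0 : R) 1)) (is_derive_cst y (0 : R) 1).
  by move/is_derive_eq; apply; rewrite /= scaler0 scale1r !addr0.
have u0 : 0 *: (x - y) + y = y by rewrite scale0r add0r.
have Dphi := @is_derive_diff_comp R X R f (fun s : R => s *: (x - y) + y) 0 _ _ Du.
rewrite u0 in Dphi; have {Dphi} := Dphi df; rewrite dfE => /is_derive1P H.
have {}H := cvg_dnbhs_at_right H.
apply: (cvgr_to_le H); near=> h.
have h0 : 0 < h by near: h; exact: nbhs_right_gt.
have h1 : h <= 1 by near: h; exact: nbhs_right_le.
rewrite /= addr0 u0 ler_pdivrMl//.
have := cf (Itv01 (ltW h0) h1) x y; rewrite !inE => /(_ I I) => cfh.
have {cfh} : f (h *: x + (1 - h) *: y) <= h * f x + (1 - h) * f y := cfh.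
rewrite (_ : h *: x + (1 - h) *: y = h *: (x - y) + y); first lra.
by rewrite scalerBl scalerBr scale1r addrA addrAC.
Unshelve. all: by end_near. Qed.

Lemma saddle_feasible (f : X -> R) (A : {linear X -> Y}) (b : Y) xs ls :
  saddle_points f A b (xs, ls) -> A xs = b.
Proof.
(* With this multiplier the left saddle inequality reads |A xs - b|^2 <= 0; [0] is a placeholder for
   the primal variable. *)
move=> /(_ 0 (ls + (A xs - b)))[/=+ _]; rewrite /lagrangian/=.
rewrite lerD2l innerDl gerDl inner_normE => H; apply/eqP.
by rewrite -subr_eq0 -normr_eq0 -sqrf_eq0 eq_le H sqr_ge0.
Qed.

Lemma aug_gapE (f : X -> R) (A : {linear X -> Y}) (b : Y) (rho : R) y xs ls :
  A xs = b ->
  aug_lagrangian rho f A b y ls - aug_lagrangian rho f A b xs ls =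
  f y - f xs + inner ls (A y - b) + rho / 2 * `|A y - b| ^+ 2.
Proof.
move=> Axs; rewrite /aug_lagrangian /lagrangian Axs subrr inner0r normr0.
by rewrite expr0n/=; ring.
Qed.

(** The right saddle inequality makes the gap of the plain Lagrangian nonnegative, which leaves the
    penalty. *)
Lemma aug_gap_ge (f : X -> R) (A : {linear X -> Y}) (b : Y) (rho : R) y xs ls :
  saddle_points f A b (xs, ls) ->
  rho / 2 * `|A y - b| ^+ 2 <=
  aug_lagrangian rho f A b y ls - aug_lagrangian rho f A b xs ls.
Proof.
move=> sp; have Axs := saddle_feasible sp; rewrite aug_gapE// lerDr.
have [_] := sp y 0; rewrite /lagrangian /= Axs subrr inner0r; lra.
Qed.

(** The penalty is quadratic, so its gradient contributes rho |A y - b|^2, twice the penalty itself.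
    The surplus half is the source of the integral estimate on the residual. *)
Lemma aug_gap_le (f : X -> R) (gradf : X -> X) (A : {linear X -> Y})
    (AT : Y -> X) (b : Y) (rho : R) y xs ls :
  convex_function [set: X] f -> is_gradient f gradf -> is_adjoint A AT ->
  A xs = b ->
  aug_lagrangian rho f A b y ls - aug_lagrangian rho f A b xs ls
    + rho / 2 * `|A y - b| ^+ 2 <=
  inner (aug_gradx rho gradf A AT b y ls) (y - xs).
Proof.
move=> cf gf adj Axs; rewrite aug_gapE//.
have := convex_gradient_le xs y cf gf.
have AE l : inner (AT l) (y - xs) = inner l (A y - b).
  by rewrite innerC -adj innerC linearB Axs.
rewrite /aug_gradx !innerDl innerZl !AE inner_normE.
rewrite -(opprB y) innerNr; lra.
Qed.

End pointwise.

(** * Big-O bounds and a damped linear equation *)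

Section damped.
Context {R : realType}.

Lemma eqO_pinfty (f g : R -> R) (K T : R) :
  (forall t, T <= t -> `|f t| <= K * g t) -> f =O_ (pinfty_nbhs R) g.
Proof.
(* The library asks for a positive constant, while [K] may have any sign. *)
move=> H; apply/eqO_exP; exists (`|K| + 1); first by rewrite ltr_wpDl.
near=> t.
have Tt : T <= t by near: t; apply: nbhs_pinfty_ge; exact: num_real.
apply: (le_trans (H t Tt)); apply: (le_trans (ler_norm _)).
by rewrite normrM ler_wpM2r// lerDl.
Unshelve. all: by end_near. Qed.

(* The square of the distance from [h] to [F] satisfies
   [phi' <= a (B^2 - phi)], and [p] is an integrating factor. *)
Lemma damped_bounded {V : hilbertType R} (h F dh dF : R -> V) (a p : R -> R)
    (B T : R) :
  (forall t, T <= t -> is_derive t 1 h (dh t)) ->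
  (forall t, T <= t -> is_derive t 1 F (dF t)) ->
  (forall t, T <= t -> is_derive t 1 p (a t * p t)) ->
  (forall t, T <= t -> 0 <= a t) -> (forall t, T <= t -> 0 < p t) ->
  (forall t, T <= t -> dh t + a t *: h t = dF t) ->
  (forall t, T <= t -> `|F t| <= B) ->
  exists K, forall t, T <= t -> `|h t| <= K.
Proof.
move=> Dh DF Dp a0 p0 ode FB.
pose u t := h t - F t.
pose psi t := p t * (inner (u t) (u t) - B ^+ 2).
have B0 : 0 <= B := le_trans (normr_ge0 _) (FB T (lexx _)).
have Dpsi t : T <= t -> is_derive t 1 psi
   (a t * p t * (inner (u t) (u t) - B ^+ 2)
    + p t * (inner (dh t - dF t) (u t) + inner (u t) (dh t - dF t))).
  move=> Tt; have Du := is_deriveB (Dh t Tt) (DF t Tt).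
  exact: is_deriveMfun (Dp t Tt) (is_deriveBcst (B ^+ 2) (is_derive_inner Du Du)).
have psi_nincr := @is_derive_le0_nonincreasing R psi _ T Dpsi _ T.
(* Since p' = a p >= 0, the weight at [t] can be replaced by [p T] when the bound on [psi] is
   undone. *)
have p_ndecr t : T <= t -> p T <= p t.
  move=> Tt; rewrite -lerN2.
  apply: (@is_derive_le0_nonincreasing R (fun s => - p s)
    (fun s => - (a s * p s)) T) => //.
    by move=> s Ts; exact: is_deriveN (Dp s Ts).
  by move=> s Ts; rewrite oppr_le0 mulr_ge0 ?a0// ltW// p0.
exists (Num.sqrt (B ^+ 2 + `|psi T| / p T) + B) => t Tt.
have -> : h t = u t + F t by rewrite subrK.
apply: (le_trans (ler_normD _ _)); rewrite lerD ?FB//.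
rewrite -(ler_sqr _ _) ?nnegrE ?sqrtr_ge0//.
have D0 : 0 <= B ^+ 2 + `|psi T| / p T.
  by rewrite addr_ge0 ?sqr_ge0// divr_ge0// ltW// p0.
rewrite sqr_sqrtr// -inner_normE -lerBlDl ler_pdivlMr ?p0//.
have [neg|pos] := leP (inner (u t) (u t) - B ^+ 2) 0.
  by apply: le_trans (normr_ge0 _); rewrite mulr_le0_ge0// ltW// p0.
apply: (@le_trans _ _ (psi t)).
  by rewrite /psi mulrC ler_wpM2r// ?p_ndecr// ltW.
apply: le_trans (ler_norm _); apply: psi_nincr => // s Ts.
have E : dh s - dF s = - (a s) *: h s.
  by rewrite -(ode s Ts) opprD addrA subrr sub0r scaleNr.
have hE : h s = u s + F s by rewrite subrK.
rewrite (innerC (dh s - _)) E hE innerZr innerDr.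
have := normr_inner (u s) (F s).
rewrite ler_norml => /andP[+ _]; rewrite inner_normE => uF.
have uFB : `|u s| * `|F s| <= `|u s| * B by rewrite ler_wpM2l// FB.
have ap : 0 <= a s * p s by rewrite mulr_ge0 ?a0// ltW// p0.
have sq : 0 <= (`|u s| - B) ^+ 2 by exact: sqr_ge0.
(* Here u' = - a (u + F), and the left-hand side is at most - (|u| - B)^2. *)
have H : `|u s| ^+ 2 - B ^+ 2 - 2 * (`|u s| ^+ 2 + inner (u s) (F s)) <= 0 by lra.
have := mulr_ge0_le0 ap H.
lra.
Qed.

(** The function is s^sigma / (s^2 xi(s)), with the real power written through [expR] and [ln]. It
    solves p' = a p for the coefficient a of the residual equation. *)
Lemma is_derive_integrating_factor (sigma : R) (xi : R -> R) t dxi :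
  0 < t -> 0 < xi t -> is_derive t 1 xi dxi ->
  is_derive t 1 (fun s => expR (sigma * ln s) / (s ^+ 2 * xi s))
    ((sigma - 2 - t * (dxi / xi t)) / t
      * (expR (sigma * ln t) / (t ^+ 2 * xi t))).
Proof.
move=> t0 xi0 Dxi.
have Did := is_derive_id t (1 : R).
have Dln := is_derive1_ln t0.
have De := @is_derive1_comp R expR (fun s => sigma * ln s) t _ _
  (is_derive_expR (sigma * ln t))
  (is_deriveMfun (is_derive_cst sigma t (1 : R)) Dln).
have D2 := is_deriveMfun (is_deriveMfun Did Did) Dxi.
have nz : t * t * xi t != 0 by rewrite !mulf_neq0// lt0r_neq0.
have D := is_deriveMfun De (@is_deriveV R (fun s => s * s * xi s) t _ _ nz D2).
have -> : (fun s => expR (sigma * ln s) / (s ^+ 2 * xi s)) =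
    (fun s => expR (sigma * ln s) * (s * s * xi s)^-1).
  by apply/funext => s; rewrite expr2.
apply: (is_derive_eq D) => /=.
rewrite [_ *: _]/GRing.scale/=; field.
by rewrite !lt0r_neq0.
Qed.

End damped.

(** * The coefficient beta(t) *)

Section betaf.
Context {R : realType}.
Implicit Types (alpha gamma beta t : R).

Lemma is_derive_betaf gamma beta t : t != 0 ->
  is_derive t 1 (betaf gamma beta) (- beta / t ^+ 2).
Proof.
move=> t0; have Dv := @is_deriveV R id t 1 1 t0 (is_derive_id t 1).
have := is_deriveDfun (is_derive_cst gamma t 1)
  (is_deriveMfun (is_derive_cst beta t 1) Dv).
move/is_derive_eq; apply.
by rewrite /= [_ *: _]mulr1 !mul0r !add0r mulrN mulNr.
Qed.

(** The last bound concerns sigma eta(t): its being at most a multiple of beta(t) lets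
    [dissipation_le] absorb the cross term with x' into beta |G|^2. *)
Lemma betaf_bounds alpha gamma beta (t0 : R) : 0 < t0 -> 0 <= alpha ->
  (0 < gamma \/ gamma = 0 /\ 0 <= beta) ->
  exists T B C, [/\ t0 <= T, 0 <= C & forall t, T <= t ->
    [/\ 0 <= betaf gamma beta t, betaf gamma beta t <= B &
        `|- (alpha / 3) * betaf gamma beta t - beta / t|
          <= C * betaf gamma beta t] ].
Proof.
move=> t00 a0 [g0|[-> b0]]; last first.
  exists t0, (beta / t0), (alpha / 3 + 1); split => [//||t t0t]; first lra.
  have tp : 0 < t by exact: lt_le_trans t0t.
  have bt0 : 0 <= beta / t by rewrite divr_ge0// ltW.
  rewrite /betaf !add0r; split => //.
    by rewrite ler_wpM2l// lef_pV2.
  by rewrite ler_norml; apply/andP; split; nra.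
(* Past this time |beta / t| <= gamma / 2, hence beta(t) >= gamma / 2 >= |beta / t|; this gives both
   the sign and the constant [alpha / 3 + 1]. *)
pose T := Num.max t0 (2 * `|beta| / gamma).
exists T, (gamma + `|beta| / t0), (alpha / 3 + 1); split => [||t Tt].
- by rewrite le_max lexx.
- lra.
have t0t : t0 <= t by apply: le_trans Tt; rewrite le_max lexx.
have tp : 0 < t by exact: lt_le_trans t0t.
have : 2 * `|beta| / gamma <= t by apply: le_trans Tt; rewrite le_max lexx orbT.
rewrite ler_pdivrMr// => bt.
have : `|beta / t| <= gamma / 2.
  by rewrite normrM normfV (gtr0_norm tp) ler_pdivrMr//; lra.
have : beta / t <= `|beta| / t0.
  apply: (le_trans (ler_norm _)); rewrite normrM normfV (gtr0_norm tp).
  by rewrite ler_wpM2l// lef_pV2.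
rewrite /betaf ler_norml => h1 /andP[h2 h3]; split; [lra|lra|].
by rewrite ler_norml; apply/andP; split; nra.
Qed.

End betaf.

(** * Lyapunov analysis of a fixed solution and saddle point *)

Section trajectory.
Context {R : realType} {X Y : hilbertType R}
  (f : X -> R) (gradf : X -> X) (A : {linear X -> Y}) (AT : Y -> X) (b : Y)
  (rho alpha gamma beta t0 : R) (xi eps : R -> R)
  (x : R -> X) (l : R -> Y) (xs : X) (ls : Y).
Context (cvxf : convex_function [set: X] f) (gradfP : is_gradient f gradf)
  (cA : continuous A) (adj : is_adjoint A AT)
  (rho0 : 0 < rho) (t00 : 0 < t0) (alpha3 : 3 < alpha)
  (gb : 0 < gamma \/ gamma = 0 /\ 0 <= beta)
  (xi0 : forall t, t0 <= t -> 0 < xi t) (Dxi : derivable_from t0 xi)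
  (eps0 : forall t, t0 <= t -> 0 <= eps t) (Deps : derivable_from t0 eps)
  (sol : solution rho alpha gamma beta t0 gradf A AT b xi eps x l)
  (sp : saddle_points f A b (xs, ls))
  (xi_growth : exists t1 delta, [/\ t0 <= t1, 0 < delta & forall t, t1 <= t ->
    (2 - 2 * alpha / 3) + t * (derive_from t0 xi t / xi t) < - delta])
  (eps_decay : exists M t1, [/\ 1 < M, t0 <= t1 & forall t, t1 <= t ->
    2 * derive_from t0 eps t
    + M * `|betaf gamma beta t| * xi t * eps t ^+ 2 <= 0]).

Local Notation dx := (derive_from t0 x).
Local Notation dl := (derive_from t0 l).
Local Notation dxi := (derive_from t0 xi).
Local Notation deps := (derive_from t0 eps).
Local Notation y := (hat t0 gamma beta x).
Local Notation bt := (betaf gamma beta).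
Local Notation G :=
  (tikhonov_gradx rho alpha gamma beta t0 gradf A AT b eps x l).
Let sigma := 2 * alpha / 3.
Let g t := aug_gradx rho gradf A AT b (y t) ls.
(* [v] and [w] satisfy [bar x - xs = v / sigma] and [bar l - ls = w / sigma]. *)
Let v t := sigma *: (x t - xs) + t *: dx t.
Let w t := sigma *: (l t - ls) + t *: dl t.
Let gap t := aug_lagrangian rho f A b (y t) ls - aug_lagrangian rho f A b xs ls.
(* [c] is [sigma * etaf]. *)
Let c t := - (alpha / 3) * bt t - beta / t.
Let S t := c t *: dx t - (t * xi t * bt t) *: G t.

Definition energy t := 2^-1 * (inner (v t) (v t) + inner (w t) (w t))
  + (sigma / 2 - 1) * sigma / 2 *
     (inner (x t - xs) (x t - xs) + inner (l t - ls) (l t - ls))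
  + t ^+ 2 * xi t * (gap t + eps t / 2 * inner (x t) (x t)).

Let sigma2 : 2 < sigma. Proof. by rewrite /sigma; have := alpha3; lra. Qed.

(** * The equations of motion and the derivative of the energy *)

Lemma sol_ddx t : t0 < t ->
  derive_from t0 dx t = - (alpha / t) *: dx t - xi t *: G t.
Proof.
move=> t0t; have [_ _ /(_ _ (ltW t0t))[+ _]] := sol.
move=> H; apply/eqP.
by rewrite -subr_eq0 scaleNr opprB opprK [_ *: G t + _]addrC addrA H.
Qed.

(** With b = A xs, bar x - xs = v / sigma and eta = c / sigma, the three terms in the bracket of the
    second equation combine into A (v + S) / sigma. *)
Lemma sol_ddl t : t0 < t ->
  t *: derive_from t0 dl t =
  - alpha *: dl t + (t * xi t / sigma) *: (A (v t) + A (S t)).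
Proof.
move=> t0t; have tp := lt_trans t00 t0t.
have [_ _ /(_ _ (ltW t0t))[_ E]] := sol.
have ddlE : derive_from t0 dl t = - (alpha / t) *: dl t
   + xi t *: (aug_gradl A b (bar t0 alpha x t) (l t)
   + etaf t0 alpha gamma beta t *: A (dx t)
   - (3 / (2 * alpha) * t * xi t * bt t) *: A (G t)).
  by apply/eqP; rewrite -subr_eq0 scaleNr opprD opprK addrA E.
have etaE : sigma * etaf t0 alpha gamma beta t = c t.
  rewrite /etaf derive_fromE// derive1E.
  have [_ ->] := is_derive_betaf gamma beta (lt0r_neq0 tp).
  rewrite /c /sigma; field.
  by rewrite lt0r_neq0//=; have := alpha3; lra.
have s0 : sigma != 0 by rewrite lt0r_neq0//; apply: lt_trans sigma2.
rewrite ddlE /S; move: (G t) => Gt.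
rewrite /aug_gradl /bar -(saddle_feasible sp).
have -> : etaf t0 alpha gamma beta t = c t / sigma.
  by rewrite -etaE mulrAC divff// mul1r.
have -> : 3 / (2 * alpha) = sigma^-1.
  by rewrite /sigma; field; have := alpha3; lra.
rewrite /v; move: (dx t) (dl t) (c t) (bt t) => q r ct btt.
have AD : {morph A : u1 u2 / u1 + u2} by exact: linearD.
have AN : {morph A : u1 / - u1} by exact: linearN.
have AZ k : {morph A : u1 / k *: u1} by exact: linearZ.
rewrite !(AD, AN, AZ).
move: (A q) (A Gt) (A (x t)) (A xs) => q' G' x' xs'.
apply: inner_inj => z; rewrite !innerE; field.
by rewrite s0 lt0r_neq0.
Qed.


(** The first equation eliminates x'' from t y'. Its damping alpha beta(t) splits as sigma beta(t)
    plus the alpha / 3 beta(t) contained in [c]; the derivative of beta(t) supplies the - beta / t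
    of [c]. *)
Lemma is_derive_hat t : t0 < t -> exists2 dy, is_derive t 1 y dy &
  t *: dy = t *: dx t - (sigma * bt t) *: dx t + S t.
Proof.
move=> t0t; have tp := lt_trans t00 t0t.
have [[Dx Ddx] _ _] := sol.
have Dx' := derivable_from_is_derive Dx t0t.
have Ddx' := derivable_from_is_derive Ddx t0t.
have Db := is_derive_betaf gamma beta (lt0r_neq0 tp).
exists (dx t + (- beta / t ^+ 2 *: dx t + bt t *: derive_from t0 dx t)).
  exact: is_deriveDfun Dx' (is_deriveZfun Db Ddx').
rewrite (sol_ddx t0t) /S /c /sigma; move: (G t) (dx t) => Gt q.
apply: inner_inj => z; rewrite !innerE; field; exact: lt0r_neq0 tp.
Qed.

Lemma is_derive_gap t dy : t0 < t -> is_derive t 1 y dy ->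
  is_derive t 1 gap (inner (g t) dy).
Proof.
move=> t0t Dy.
have Dz := is_deriveBcst b (is_derive_linear cA Dy).
have Df := is_derive_diff_comp (gradfP (y t)).1 Dy.
have D := is_deriveBcst (f xs) (is_deriveDfun Df (is_deriveDfun
   (is_derive_inner (is_derive_cst ls t 1) Dz)
   (is_deriveMfun (is_derive_cst (rho / 2) t 1) (is_derive_inner Dz Dz)))).
rewrite (_ : gap = (fun s => f (y s) + (inner (cst ls s) (A (y s) - b) +
  cst (rho / 2) s * inner (A (y s) - b) (A (y s) - b)) - f xs)); last first.
  apply/funext => s; rewrite /gap (aug_gapE _ _ _ _ (saddle_feasible sp)).
  by rewrite inner_normE /=; ring.
apply: is_derive_eq D _.
rewrite (gradfP (y t)).2 inner0l mul0r !add0r /g /aug_gradx.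
move: (A (y t) - b) => z; rewrite !innerDl innerZl.
rewrite -!(innerC dy) -!adj (innerC (A dy) ls) (innerC (A dy)) /=.
by field.
Qed.


(** The derivative of [energy] after the cancellations of [energy_rate_identity]: velocity damping,
    the term t xi <G - eps x, S>, two terms to be treated by convexity, then the derivatives of the
    weight t^2 xi and of eps. *)
Definition energy_rate t :=
  - (sigma / 2 - 1) * t * (inner (dx t) (dx t) + inner (dl t) (dl t))
  + inner ((t * xi t) *: G t - (t * xi t * eps t) *: x t)
          (c t *: dx t - bt t *: ((t * xi t) *: G t))
  - t * xi t * sigma * inner (g t) (y t - xs)
  - t * xi t * sigma * eps t * inner (x t) (x t - xs)
  + t * (2 * xi t + t * dxi t) * (gap t + eps t / 2 * inner (x t) (x t))
  + t ^+ 2 * xi t * deps t / 2 * inner (x t) (x t).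

Lemma is_derive_energy t : t0 < t -> is_derive t 1 energy (energy_rate t).
Proof.
move=> t0t; have tp := lt_trans t00 t0t.
have [[Dx Ddx] [Dl Ddl] _] := sol.
have Dx' := derivable_from_is_derive Dx t0t.
have Ddx' := derivable_from_is_derive Ddx t0t.
have Dl' := derivable_from_is_derive Dl t0t.
have Ddl' := derivable_from_is_derive Ddl t0t.
have Dxi' := derivable_from_is_derive Dxi t0t.
have Deps' := derivable_from_is_derive Deps t0t.
have Did := is_derive_id t 1.
have [dy Dy dyE] := is_derive_hat t0t.
have Dgap := is_derive_gap t0t Dy.
have Dk (k : R) := is_derive_cst k t 1.
have Dxs := is_deriveBcst xs Dx'.
have Dls := is_deriveBcst ls Dl'.
have Dv := is_deriveDfun (is_deriveZfun (Dk sigma) Dxs) (is_deriveZfun Did Ddx').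
have Dw := is_deriveDfun (is_deriveZfun (Dk sigma) Dls) (is_deriveZfun Did Ddl').
have D := is_deriveDfun (is_deriveDfun
  (is_deriveMfun (Dk 2^-1)
     (is_deriveDfun (is_derive_inner Dv Dv) (is_derive_inner Dw Dw)))
  (is_deriveMfun (Dk ((sigma / 2 - 1) * sigma / 2))
     (is_deriveDfun (is_derive_inner Dxs Dxs) (is_derive_inner Dls Dls))))
  (is_deriveMfun (is_deriveMfun (is_deriveMfun Did Did) Dxi')
    (is_deriveDfun Dgap (is_deriveMfun (is_deriveMfun Deps' (Dk 2^-1))
      (is_derive_inner Dx' Dx')))).
have -> : energy = fun s => 2^-1 * (inner (v s) (v s) + inner (w s) (w s)) +
   (sigma / 2 - 1) * sigma / 2 *
     (inner (x s - xs) (x s - xs) + inner (l s - ls) (l s - ls)) +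
   s * s * xi s * (gap s + eps s * 2^-1 * inner (x s) (x s)).
  by apply/funext => s; rewrite /energy expr2.
apply: (is_derive_eq D).
rewrite /energy_rate /=.
have s0 : sigma != 0 by rewrite lt0r_neq0//; apply: lt_trans sigma2.
(* Replacing the multiplier bar l by [ls] in the gradient isolates a difference of values of [AT],
   which plays the role of [P] in the identity. *)
have GE : G t = g t + (AT (bar t0 alpha l t) - AT ls) + eps t *: x t.
  rewrite /tikhonov_gradx /g /aug_gradx; congr (_ + _).
  by apply: inner_inj => z; rewrite !innerE; ring.
have PE u : inner (AT (bar t0 alpha l t) - AT ls) u = sigma^-1 * inner (w t) (A u).
  rewrite innerDl innerNl -!(innerC u) -!adj !(innerC (A u)) -innerNl -innerDl -innerZl.
  congr (inner _ (A u)); rewrite /w /bar; apply: inner_inj => z; rewrite !innerE.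
  by rewrite /sigma; field; have := alpha3; lra.
(* These are v' and w' as the rules produce them; the two equations then remove the second
   derivatives. *)
set dv := 0 *: (x t - xs) + _ + _.
set dw := 0 *: (l t - ls) + _ + _.
have dvE : dv = (1 - sigma / 2) *: dx t - (t * xi t) *: G t.
  rewrite /dv (sol_ddx t0t); apply: inner_inj => z; rewrite !innerE /sigma.
  by field; exact: lt0r_neq0 tp.
have dwE : dw = (1 - sigma / 2) *: dl t + (t * xi t / sigma) *: (A (v t) + A (S t)).
  rewrite /dw (sol_ddl t0t); apply: inner_inj => z; rewrite !innerE.
  rewrite /sigma; field.
  by have := alpha3; lra.
have := energy_rate_identity (lt0r_neq0 tp) s0 (erefl (v t)) (erefl (w t))
  (erefl (y t)) (erefl (S t)) dvE dwE dyE GE PE.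
move=> <-; rewrite -/(v t) -/(w t) (innerC dv) (innerC dw).
rewrite (innerC (dx t) (x t - xs)) (innerC (dl t) (l t - ls)).
rewrite (innerC (dx t) (x t)).
move: (inner (v t) dv) (inner (w t) dw) (inner (x t) (dx t)) (inner (g t) dy).
move: (inner (x t - xs) (dx t)) (inner (l t - ls) (dl t)).
by move=> *; field.
Qed.


(** * The dissipation inequality *)

Lemma gap_ge0 t : 0 <= gap t.
Proof.
apply: le_trans (aug_gap_ge rho (y t) sp).
by rewrite mulr_ge0 ?sqr_ge0// divr_ge0// ltW.
Qed.

(** The sum of the four integrands to be bounded, so that a single differential inequality serves
    all of them. *)
Definition dissipated t := t * xi t * gap t + t * xi t * `|A (y t) - b| ^+ 2
  + t * xi t * eps t * `|x t| ^+ 2 + t * (`|dx t| ^+ 2 + `|dl t| ^+ 2).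

Lemma energy_rate_le :
  exists T k, [/\ t0 < T, 0 < k & forall t, T <= t ->
    energy_rate t + k * dissipated t
      <= sigma / 2 * `|xs| ^+ 2 * (t * xi t * eps t)].
Proof.
have [t1 [delta [t01 delta0 Hxi]]] := xi_growth.
have [M [t2 [M1 t02 Heps]]] := eps_decay.
have a0 : 0 <= alpha by have := alpha3; lra.
have [t3 [B [C [t03 C0 Hb]]]] := betaf_bounds t00 a0 gb.
have s2 := sigma2.
have sg0 : 0 <= sigma by apply: ltW; apply: lt_trans s2.
pose K := C ^+ 2 / 4 * (1 + (M - 1)^-1).
have K0 : 0 <= K.
  rewrite /K mulr_ge0 ?divr_ge0 ?sqr_ge0// addr_ge0// invr_ge0; lra.
(* Half of the velocity damping. One half absorbs the beta K |x'|^2 left by [dissipation_le], once t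
   >= B K / m; the other half is kept in [dissipated]. *)
pose m := (sigma / 2 - 1) / 2.
have m0 : 0 < m by rewrite /m; lra.
pose T := Num.max (t0 + 1) (Num.max t1 (Num.max t2 (Num.max t3 (B * K / m)))).
(* The surplus coefficients: delta / 2 on eps |x|^2 (and delta on the gap), sigma rho / 2 on the
   residual, m on the velocities. *)
pose k := Num.min (delta / 2) (Num.min (sigma * rho / 2) m).
have sr0 : 0 < sigma * rho / 2 by rewrite divr_gt0// mulr_gt0//; lra.
exists T, k; split.
- by rewrite /T lt_max ltrDl ltr01.
- by rewrite /k !lt_min m0 sr0 divr_gt0.
move=> t; rewrite /T !ge_max => /andP[t0t /andP[t1t /andP[t2t /andP[t3t Bt]]]].
have [b0 bB cC] := Hb t t3t.
have {}t0t : t0 < t by apply: lt_le_trans t0t; rewrite ltrDl.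
have tp := lt_trans t00 t0t; have xp := xi0 (ltW t0t); have ep := eps0 (ltW t0t).
have [kd ks km] : [/\ k <= delta / 2, k <= sigma * rho / 2 & k <= m].
  by rewrite /k; split; rewrite !ge_min lexx ?orbT.
have txp : 0 < t * xi t by rewrite mulr_gt0.
have tp0 := ltW tp; have xp0 := ltW xp.
have H1 := dissipation_le ((t * xi t) *: G t) ((t * xi t * eps t) *: x t)
  (dx t) b0 cC M1.
have H4 := aug_gap_le rho (y t) ls cvxf gradfP adj (saddle_feasible sp).
(* This is |x - xs|^2 >= 0 rearranged; it brings |xs|^2 into the final bound. *)
have H6 : (inner (x t) (x t) - inner xs xs) / 2 <= inner (x t) (x t - xs).
  by have := inner_ge0 (x t - xs); rewrite !innerE (innerC xs); lra.
have H5 : t * (2 * xi t + t * dxi t) <= t * xi t * (sigma - delta).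
  have H : t * xi t * (2 - sigma + t * (dxi t / xi t)) <= t * xi t * - delta.
    by rewrite ler_pM2l// ltW// Hxi.
  have E : t * xi t * (2 - sigma + t * (dxi t / xi t)) =
    t * (2 * xi t + t * dxi t) - t * xi t * sigma.
    by field; rewrite lt0r_neq0.
  by rewrite E in H; lra.
have H2 := Heps t t2t; rewrite (ger0_norm b0) in H2.
rewrite -/K in H1; rewrite -/(g t) in H4.
rewrite /energy_rate /dissipated -!inner_normE.
rewrite -!inner_normE in H4.
set D := inner (_ - _) (_ - _) in H1 *.
have gp := gap_ge0 t; rewrite -/(gap t) in H4.
have zp := inner_ge0 (A (y t) - b).
have xxp := inner_ge0 (x t); have qp := inner_ge0 (dx t); have rp := inner_ge0 (dl t).
rewrite [in X in _ * (_ * X + _)]innerZl innerZr in H1.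
rewrite -/sigma.
move: (gap t) (inner (g t) _) (inner (A (y t) - b) _) (inner (x t) (x t))
  (inner (dx t) _) (inner (dl t) _) (inner (x t) (x t - xs)) (inner xs xs)
  D H1 H4 H6 H5 H2 gp zp xxp qp rp =>
  gt gy z2 x2 q2 r2 xxs xs2 D H1 H4 H6 H5 H2 gp zp xxp qp rp.
have {}H4 : t * xi t * sigma * (gt + rho / 2 * z2) <= t * xi t * sigma * gy.
  by rewrite ler_wpM2l// !mulr_ge0.
have {}H6 : t * xi t * sigma * eps t * ((x2 - xs2) / 2) <= t * xi t * sigma * eps t * xxs.
  by rewrite ler_wpM2l// !mulr_ge0.
have {}H5 : t * (2 * xi t + t * dxi t) * (gt + eps t / 2 * x2) <=
    t * xi t * (sigma - delta) * (gt + eps t / 2 * x2).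
  by rewrite ler_wpM2r// addr_ge0// !mulr_ge0.
(* The decay of eps pays for the beta M / 4 |t xi eps x|^2 left by [dissipation_le]. *)
have {}H2 : t ^+ 2 * xi t * x2 / 4 * (2 * deps t + M * bt t * xi t * eps t ^+ 2) <= 0.
  by rewrite mulr_ge0_le0// !mulr_ge0 ?sqr_ge0.
have H3 : bt t * K * q2 <= m * t * q2.
  rewrite ler_wpM2r//; apply: (@le_trans _ _ (B * K)); first by rewrite ler_wpM2r.
  by move: Bt; rewrite ler_pdivrMr// [t * m]mulrC.
have P1 : 0 <= (delta / 2 - k) * (t * xi t * gt) by rewrite !mulr_ge0 ?subr_ge0.
have P2 : 0 <= (sigma * rho / 2 - k) * (t * xi t * z2) by rewrite !mulr_ge0 ?subr_ge0.
have P3 : 0 <= (delta / 2 - k) * (t * xi t * eps t * x2) by rewrite !mulr_ge0 ?subr_ge0.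
have P4 : 0 <= (m - k) * (t * (q2 + r2)) by rewrite !mulr_ge0 ?subr_ge0 ?addr_ge0.
have P5 : 0 <= delta / 2 * (t * xi t * gt) by rewrite !mulr_ge0// ltW// divr_gt0.
have P6 : 0 <= m * (t * r2) by apply: mulr_ge0; [exact: ltW|exact: mulr_ge0].
move: H1 H2 H3 H4 H5 H6 P1 P2 P3 P4 P5 P6; rewrite /m.
move: (k) (K) (bt t) (xi t) (dxi t) (eps t) (deps t) (sigma).
move=> *. lra.
Qed.

(** * Coercivity of the energy and its boundedness *)

Let c0 := sigma / 2 * `|xs| ^+ 2.
Let c0_ge0 : 0 <= c0.
Proof. by have s2 := sigma2; rewrite /c0 mulr_ge0 ?sqr_ge0//; lra. Qed.

Let C1 := (sigma / 2 - 1) * sigma / 2.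
Let C1_gt0 : 0 < C1.
Proof.
by have s2 := sigma2; rewrite /C1 divr_gt0// mulr_gt0//; lra.
Qed.

Lemma energy_ge t : t0 <= t ->
  [/\ 2^-1 * `|v t| ^+ 2 + 2^-1 * `|w t| ^+ 2 <= energy t,
      C1 * `|x t - xs| ^+ 2 + C1 * `|l t - ls| ^+ 2 <= energy t &
      t ^+ 2 * xi t * gap t <= energy t].
Proof.
move=> t0t; have tp := lt_le_trans t00 t0t.
have P1 : 0 <= 2^-1 * (inner (v t) (v t) + inner (w t) (w t)).
  by rewrite mulr_ge0 ?addr_ge0 ?inner_ge0// invr_ge0.
have P2 : 0 <= C1 * (inner (x t - xs) (x t - xs) + inner (l t - ls) (l t - ls)).
  by apply: mulr_ge0; [exact: ltW C1_gt0|rewrite addr_ge0 ?inner_ge0].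
have P3 : 0 <= t ^+ 2 * xi t * gap t.
  by rewrite mulr_ge0 ?gap_ge0// mulr_ge0 ?sqr_ge0// ltW// xi0.
have P4 : 0 <= t ^+ 2 * xi t * (eps t / 2 * inner (x t) (x t)).
  by rewrite mulr_ge0// mulr_ge0 ?sqr_ge0 ?inner_ge0 ?divr_ge0 ?eps0// ltW// xi0.
rewrite /energy -/C1 -!inner_normE.
by split; lra.
Qed.

Let C2 := 4 + 2 * sigma ^+ 2 / C1.
Let C2_ge0 : 0 <= C2.
Proof.
rewrite /C2 addr_ge0//; apply: divr_ge0; last exact: ltW C1_gt0.
by rewrite mulr_ge0 ?sqr_ge0.
Qed.

(** From t x' = v - sigma (x - xs), and likewise for l, with |p - q|^2 <= 2 |p|^2 + 2 |q|^2. The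
    energy controls |v|^2 + |w|^2 with factor 2 and the squared distances with factor 1 / C1, whence
    [C2]. *)
Lemma speed_le t : t0 <= t ->
  t ^+ 2 * (`|dx t| ^+ 2 + `|dl t| ^+ 2) <= C2 * energy t.
Proof.
move=> t0t; have [H1 H2 _] := energy_ge t0t.
have para (Z : hilbertType R) (p q r : Z) : t *: p = q - sigma *: r ->
    t ^+ 2 * `|p| ^+ 2 <= 2 * `|q| ^+ 2 + 2 * sigma ^+ 2 * `|r| ^+ 2.
  move=> pE; have := inner_ge0 (q + sigma *: r).
  have : inner (t *: p) (t *: p) = inner (q - sigma *: r) (q - sigma *: r).
    by rewrite pE.
  rewrite !innerE (innerC r q) !inner_normE.
  by move: (inner q r) => qr; lra.
have hx : t ^+ 2 * `|dx t| ^+ 2 <=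
    2 * `|v t| ^+ 2 + 2 * sigma ^+ 2 * `|x t - xs| ^+ 2.
  by apply: para; rewrite /v addrAC subrr add0r.
have hl : t ^+ 2 * `|dl t| ^+ 2 <=
    2 * `|w t| ^+ 2 + 2 * sigma ^+ 2 * `|l t - ls| ^+ 2.
  by apply: para; rewrite /w addrAC subrr add0r.
have H3 : `|x t - xs| ^+ 2 + `|l t - ls| ^+ 2 <= energy t / C1.
  by rewrite ler_pdivlMr ?C1_gt0// mulrC mulrDr.
have s0 : 0 <= 2 * sigma ^+ 2 by rewrite mulr_ge0 ?sqr_ge0.
have {}H3 := ler_wpM2l s0 H3.
rewrite /C2; lra.
Qed.

Lemma dissipated_terms t : t0 <= t ->
  [/\ 0 <= t * xi t * gap t, 0 <= t * xi t * `|A (y t) - b| ^+ 2,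
      0 <= t * xi t * eps t * `|x t| ^+ 2 &
      0 <= t * (`|dx t| ^+ 2 + `|dl t| ^+ 2)].
Proof.
move=> t0t; have tp := ltW (lt_le_trans t00 t0t); have xp := ltW (xi0 t0t).
have txp : 0 <= t * xi t by exact: mulr_ge0.
have txe := mulr_ge0 txp (eps0 t0t).
split; [exact: mulr_ge0 txp (gap_ge0 t)|exact: mulr_ge0 txp (sqr_ge0 _)
       |exact: mulr_ge0 txe (sqr_ge0 _)|].
by rewrite mulr_ge0// addr_ge0 ?sqr_ge0.
Qed.

Lemma dissipated_terms_continuous T : t0 < T ->
  [/\ {within `[T, +oo[, continuous (fun t => t * xi t * gap t)},
      {within `[T, +oo[, continuous (fun t => t * xi t * `|A (y t) - b| ^+ 2)},
      {within `[T, +oo[, continuous (fun t => t * xi t * eps t * `|x t| ^+ 2)} &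
      {within `[T, +oo[, continuous
         (fun t => t * (`|dx t| ^+ 2 + `|dl t| ^+ 2))} ].
Proof.
move=> t0T; have [[Dx Ddx] [Dl Ddl] _] := sol.
have Dtxi t : T <= t -> is_derive t 1 (fun s => s * xi s) (1 * xi t + t * dxi t).
  move=> Tt; have t0t := lt_le_trans t0T Tt.
  exact: is_deriveMfun (is_derive_id t 1) (derivable_from_is_derive Dxi t0t).
have -> : (fun t => t * xi t * `|A (y t) - b| ^+ 2) =
    (fun t => t * xi t * inner (A (y t) - b) (A (y t) - b)).
  by apply/funext => t; rewrite inner_normE.
have -> : (fun t => t * xi t * eps t * `|x t| ^+ 2) =
    (fun t => t * xi t * eps t * inner (x t) (x t)).
  by apply/funext => t; rewrite inner_normE.
have -> : (fun t => t * (`|dx t| ^+ 2 + `|dl t| ^+ 2)) =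
    (fun t => t * (inner (dx t) (dx t) + inner (dl t) (dl t))).
  by apply/funext => t; rewrite !inner_normE.
split; apply: halfline_continuous_within => t Tt; have t0t := lt_le_trans t0T Tt;
  have [dy Dy _] := is_derive_hat t0t.
- exact: is_derive_continuous (is_deriveMfun (Dtxi t Tt) (is_derive_gap t0t Dy)).
- have Dz := is_deriveBcst b (is_derive_linear cA Dy).
  exact: is_derive_continuous (is_deriveMfun (Dtxi t Tt) (is_derive_inner Dz Dz)).
- have Dx' := derivable_from_is_derive Dx t0t.
  have Deps' := derivable_from_is_derive Deps t0t.
  exact: is_derive_continuous
    (is_deriveMfun (is_deriveMfun (Dtxi t Tt) Deps') (is_derive_inner Dx' Dx')).
- have Ddx' := derivable_from_is_derive Ddx t0t.
  have Ddl' := derivable_from_is_derive Ddl t0t.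
  exact: is_derive_continuous (is_deriveMfun (is_derive_id t 1)
    (is_deriveDfun (is_derive_inner Ddx' Ddx') (is_derive_inner Ddl' Ddl'))).
Qed.

(** With P a bounded primitive of t xi eps, W = energy - c0 P is nonincreasing, which bounds the
    energy. Its decrease dominates k times [dissipated], so F = - W / k is the function needed by
    the integral criterion. *)
Lemma energy_bounded :
  (\int[lebesgue_measure]_(t in `[t0, +oo[) (t * xi t * eps t)%:E < +oo)%E ->
  exists T K F dF, [/\ t0 < T, (forall t, T <= t -> energy t <= K),
    (forall t, T <= t -> is_derive t 1 F (dF t)),
    (forall t, T <= t -> dissipated t <= dF t) &
    (forall t, T <= t -> F t <= K)].
Proof.
move=> fin.
have [T [k [t0T k0 Hrate]]] := energy_rate_le.
have [||P [K HP]] := bounded_primitive _ _ fin.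
- apply: within_continuousM; last exact: derivable_from_within_continuous.
  apply: within_continuousM; last exact: derivable_from_within_continuous.
  by apply: continuous_subspaceT => s; exact: cvg_id.
- move=> t t0t; rewrite mulr_ge0 ?eps0// mulr_ge0// ltW ?xi0//.
  exact: lt_le_trans t0t.
pose W t := energy t - c0 * P t.
have DW t : T <= t ->
    is_derive t 1 W (energy_rate t - c0 * (t * xi t * eps t)).
  move=> Tt; have t0t := lt_le_trans t0T Tt.
  have [DP _] := HP t t0t.
  exact: is_deriveB (is_derive_energy t0t) (is_deriveZ c0 DP).
have Wd t : T <= t ->
    energy_rate t - c0 * (t * xi t * eps t) <= - (k * dissipated t).
  by move=> /Hrate; rewrite -/c0; lra.
have diss0 t : T <= t -> 0 <= dissipated t.
  move=> Tt; have t0t : t0 <= t by exact: le_trans (ltW t0T) Tt.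
  have [d1 d2 d3 d4] := dissipated_terms t0t.
  by rewrite /dissipated; do 3 ?[apply: addr_ge0].
have WT t : T <= t -> W t <= W T.
  apply: (is_derive_le0_nonincreasing DW) => // s Ts.
  by apply: le_trans (Wd s Ts) _; rewrite oppr_le0 mulr_ge0 ?diss0// ltW.
have cP t : T <= t -> c0 * P t <= c0 * K.
  move=> Tt; rewrite ler_wpM2l ?c0_ge0//.
  by have [_ /andP[]] := HP t (lt_le_trans t0T Tt).
(* One constant for both bounds: the first two summands bound the energy, the last bounds [F]. *)
exists T, (`|W T| + c0 * K + k^-1 * (c0 * K)), (fun t => - k^-1 * W t),
  (fun t => - k^-1 * (energy_rate t - c0 * (t * xi t * eps t))).
have cK : 0 <= c0 * K.
  apply: le_trans (cP T (lexx _)); rewrite mulr_ge0 ?c0_ge0//.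
  by have [_ /andP[]] := HP T t0T.
have kcK : 0 <= k^-1 * (c0 * K) by rewrite mulr_ge0// invr_ge0 ltW.
split; first exact: t0T.
- move=> t Tt; have := WT t Tt; have := cP t Tt; rewrite {1}/W.
  by have := ler_norm (W T); lra.
- by move=> t Tt; exact: is_deriveZ (DW t Tt).
- by move=> t Tt; rewrite mulNr -mulrN ler_pdivlMl//; have := Wd t Tt; lra.
- move=> t Tt; have := cP t Tt => cPt.
  have Wge : - W t <= c0 * K.
    rewrite /W; have [H _ _] := energy_ge (ltW (lt_le_trans t0T Tt)).
    suff : 0 <= energy t by lra.
    by apply: le_trans H; rewrite addr_ge0// mulr_ge0 ?sqr_ge0 ?invr_ge0.
  have : k^-1 * - W t <= k^-1 * (c0 * K) by rewrite ler_wpM2l// invr_ge0 ltW.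
  by have := normr_ge0 (W T); lra.
Qed.

(** * Boundedness of the trajectory, feasibility rate and integral estimates *)

Let mu := @lebesgue_measure R.

(** A crude bound in place of a square root, from a <= a^2 + 1/4. *)
Let sqr_boundW (a K : R) : a ^+ 2 <= K -> a <= K + 1.
Proof.
by move=> aK; have := sqr_ge0 (a - 2^-1); rewrite sqrrB; lra.
Qed.

(** The energy controls the trajectory only past [T]; on the compact interval [t0, T] the extreme
    value theorem takes over. *)
Lemma trajectory_bounded T K : t0 <= T -> (forall t, T <= t -> energy t <= K) ->
  exists K', forall t, t0 <= t -> `|x t| + `|l t| <= K'.
Proof.
move=> t0T EK; have [[Dx _] [Dl _] _] := sol.
pose phi s := `|x s| + `|l s|.
have cphi : {within `[t0, T], continuous phi}.
  have sub : `[t0, T] `<=` `[t0, +oo[ by move=> s /=; rewrite !in_itv/= => /andP[->].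
  have cx := continuous_subspaceW sub (derivable_from_within_continuous Dx).
  have cl := continuous_subspaceW sub (derivable_from_within_continuous Dl).
  by move=> s; apply: cvgD; apply: cvg_norm; [exact: cx|exact: cl].
have [s _ phis] := EVT_max t0T cphi.
exists (Num.max (phi s) (`|xs| + `|ls| + 2 * (K / C1 + 1))) => t t0t.
have [tT|Tt] := leP t T.
  by rewrite le_max phis// in_itv/= t0t.
rewrite le_max; apply/orP; right.
have [_ + _] := energy_ge t0t.
rewrite -mulrDr => H.
have {}H : `|x t - xs| ^+ 2 + `|l t - ls| ^+ 2 <= K / C1.
  rewrite ler_pdivlMr ?C1_gt0// mulrC (le_trans H)// EK//; exact: ltW.
have h1 : `|x t - xs| <= K / C1 + 1.
  by apply: sqr_boundW; apply: le_trans H; rewrite lerDl sqr_ge0.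
have h2 : `|l t - ls| <= K / C1 + 1.
  by apply: sqr_boundW; apply: le_trans H; rewrite lerDr sqr_ge0.
have := ler_normD (x t - xs) xs; have := ler_normD (l t - ls) ls.
rewrite !subrK; lra.
Qed.

Lemma residual_bounded T K : t0 < T -> (forall t, T <= t -> energy t <= K) ->
  exists K' T', forall t, T' <= t -> t ^+ 2 * xi t * `|A (y t) - b| <= K'.
Proof.
move=> t0T EK; have [[Dx Ddx] [Dl Ddl] _] := sol.
have [K1 xlK] := trajectory_bounded (ltW t0T) EK.
have [t1 [delta [t01 delta0 Hxi]]] := xi_growth.
pose T' := Num.max T t1.
have TT' t : T' <= t -> [/\ T <= t, t1 <= t & t0 < t].
  rewrite /T' ge_max => /andP[Tt t1t]; split => //; exact: lt_le_trans t0T Tt.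
have s2 := sigma2.
have sg0 : 0 <= sigma by apply: ltW; apply: lt_trans s2.
pose z t := A (y t) - b.
pose h t := (t * t * xi t) *: z t.
pose F t := sigma *: (t *: dl t + (alpha - 1) *: l t).
pose a t := (sigma - 2 - t * (dxi t / xi t)) / t.
pose p t := expR (sigma * ln t) / (t ^+ 2 * xi t).
pose dy t := t^-1 *: (t *: dx t - (sigma * bt t) *: dx t + S t).
pose dh t := ((1 * t + t * 1) * xi t + t * t * dxi t) *: z t
  + (t * t * xi t) *: A (dy t).
pose dF t := sigma *: (1 *: dl t + t *: derive_from t0 dl t + (alpha - 1) *: dl t).
have Dz t : T' <= t -> is_derive t 1 z (A (dy t)).
  move=> /TT'[_ _ t0t]; have [dy' Dy' dyE] := is_derive_hat t0t.
  have <- : dy' = dy t.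
    by rewrite /dy -dyE scalerA mulVf ?scale1r// lt0r_neq0// (lt_trans t00).
  have D := is_deriveBcst b (is_derive_linear cA Dy'); exact: D.
(* In this bound on |F|, [C2 * K + 1] dominates t |l'|, whose square is at most [C2 * K], and [K1]
   dominates |l|. *)
have [|||||||C hC] := @damped_bounded R Y h F dh dF a p
  (sigma * (C2 * K + 1 + (alpha - 1) * K1)) T'.
- move=> t T't; have [Tt _ t0t] := TT' t T't.
  have Did := is_derive_id t (1 : R).
  have Dxi' := derivable_from_is_derive Dxi t0t.
  have D := is_deriveZfun (is_deriveMfun (is_deriveMfun Did Did) Dxi') (Dz t T't).
  exact: D.
- move=> t T't; have [Tt _ t0t] := TT' t T't.
  have Dl' := derivable_from_is_derive Dl t0t.
  have Ddl' := derivable_from_is_derive Ddl t0t.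
  have D := is_deriveZ sigma (is_deriveDfun
    (is_deriveZfun (is_derive_id t 1) Ddl') (is_deriveZ (alpha - 1) Dl')).
  exact: D.
- move=> t T't; have [Tt _ t0t] := TT' t T't.
  have Dxi' := derivable_from_is_derive Dxi t0t.
  exact: (@is_derive_integrating_factor R sigma xi t (dxi t) (lt_trans t00 t0t)
    (xi0 (ltW t0t)) Dxi').
- move=> t T't; have [Tt t1t t0t] := TT' t T't.
  (* The growth condition on xi makes the numerator larger than delta. *)
  rewrite /a divr_ge0// ?(ltW (lt_trans t00 t0t))//.
  by have := Hxi t t1t; rewrite -/sigma; lra.
- move=> t T't; have [Tt _ t0t] := TT' t T't.
  rewrite /p; apply: divr_gt0; first exact: expR_gt0.
  by apply: mulr_gt0; [exact: exprn_gt0 (lt_trans t00 t0t)|exact: xi0 (ltW t0t)].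
- move=> t T't; have [Tt _ t0t] := TT' t T't.
  have tp := lt_trans t00 t0t; have xp := xi0 (ltW t0t).
  (* In h' + a h the derivative of t^2 xi cancels, leaving t xi (sigma z + t z'). This equals t xi A
     (v + S), which the second equation identifies with sigma (t l'' + alpha l'). *)
  rewrite /dh /dF (sol_ddl t0t) /h /dy /a /z /v -(saddle_feasible sp).
  rewrite /hat; move: (S t) (dx t) (dl t) => St q r.
  have AD : {morph A : u1 u2 / u1 + u2} by exact: linearD.
  have AN : {morph A : u1 / - u1} by exact: linearN.
  have AZ k : {morph A : u1 / k *: u1} by exact: linearZ.
  rewrite !(AD, AN, AZ).
  apply: inner_inj => u; rewrite !innerE; field.
  by rewrite !lt0r_neq0//; apply: lt_trans s2.
- move=> t T't; have [Tt _ t0t] := TT' t T't.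
  rewrite /F normrZ ger0_norm// ler_wpM2l//.
  apply: (le_trans (ler_normD _ _)); rewrite !normrZ.
  rewrite (gtr0_norm (lt_trans t00 t0t)) ger0_norm; last by have := alpha3; lra.
  apply: lerD.
    apply: sqr_boundW; rewrite exprMn; have := speed_le (ltW t0t).
    have := ler_wpM2l C2_ge0 (EK t Tt).
    by have := mulr_ge0 (sqr_ge0 t) (sqr_ge0 `|dx t|); lra.
  rewrite ler_wpM2l//; first by have := alpha3; lra.
  by apply: le_trans (xlK t (ltW t0t)); rewrite lerDr.
exists C, T' => t T't; have [_ _ t0t] := TT' t T't.
have := hC t T't; rewrite /h normrZ ger0_norm ?expr2//.
have tp := ltW (lt_trans t00 t0t).
by rewrite !mulr_ge0// ltW// xi0// ltW.
Qed.

Lemma prod_norm_le (p : X) (q : Y) : prod_norm p q <= `|p| + `|q|.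
Proof.
rewrite /prod_norm -ler_sqr ?nnegrE ?sqrtr_ge0 ?addr_ge0//.
rewrite sqr_sqrtr ?addr_ge0 ?sqr_ge0// sqrrD lerD2r lerDl.
by rewrite mulrn_wge0// mulr_ge0.
Qed.

Lemma convergence_rates :
  (\int[mu]_(t in `[t0, +oo[) (t * xi t * eps t)%:E < +oo)%E ->
  (exists K, forall t, t0 <= t -> prod_norm (x t) (l t) <= K) /\
  (exists2 t2, t0 <= t2 &
    [/\ (\int[mu]_(t in `[t2, +oo[) (t * xi t * gap t)%:E < +oo)%E,
        (\int[mu]_(t in `[t2, +oo[)
           (t * xi t * eps t * `|x t| ^+ 2)%:E < +oo)%E,
        (\int[mu]_(t in `[t2, +oo[)
           (t * (`|dx t| ^+ 2 + `|dl t| ^+ 2))%:E < +oo)%E &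
        (\int[mu]_(t in `[t2, +oo[)
           (t * xi t * `|A (y t) - b| ^+ 2)%:E < +oo)%E]) /\
  [/\ gap =O_ (pinfty_nbhs R) (fun t => (t ^+ 2 * xi t)^-1),
      (fun t => prod_norm (dx t) (dl t)) =O_ (pinfty_nbhs R) (fun t => t^-1),
      (fun t => `|A (y t) - b|) =O_ (pinfty_nbhs R)
        (fun t => (t ^+ 2 * xi t)^-1) &
      (fun t => `|f (y t) - f xs|) =O_ (pinfty_nbhs R)
        (fun t => (t ^+ 2 * xi t)^-1)].
Proof.
move=> fin; have [T [K [F [dF [t0T EK DF FdF FK]]]]] := energy_bounded fin.
split; first last; first split.
- exists T; first exact: ltW.
  have [c1 c2 c3 c4] := dissipated_terms_continuous t0T.
  have dom (p : R -> R) : {within `[T, +oo[, continuous p} ->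
      (forall t, T <= t -> 0 <= p t <= dissipated t) ->
      (\int[mu]_(t in `[T, +oo[) (p t)%:E < +oo)%E.
    move=> cp pd; apply: (dominated_integral_lt_pinfty cp _ DF _ FK).
      by move=> t /pd/andP[].
    by move=> t Tt; have /andP[_ /le_trans] := pd t Tt; apply; exact: FdF.
  have terms t (Tt : T <= t) := dissipated_terms (le_trans (ltW t0T) Tt).
  split; apply: dom => // t Tt; have [d1 d2 d3 d4] := terms t Tt;
    by rewrite /dissipated; lra.
- have scale t : T <= t -> 0 < t ^+ 2 * xi t.
    move=> Tt; have t0t := lt_le_trans t0T Tt.
    by apply: mulr_gt0; [exact: exprn_gt0 (lt_trans t00 t0t)|exact: xi0 (ltW t0t)].
  have [K' [T' zK]] := residual_bounded t0T EK.
  have gapK t : T <= t -> t ^+ 2 * xi t * gap t <= K.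
    move=> Tt; have [_ _ H] := energy_ge (le_trans (ltW t0T) Tt).
    exact: le_trans H (EK t Tt).
  split.
  + apply: (@eqO_pinfty R _ _ K T) => t Tt.
    by rewrite ger0_norm ?gap_ge0// ler_pdivlMr ?scale// mulrC gapK.
  + apply: (@eqO_pinfty R _ _ (C2 * K + 1) T) => t Tt.
    have t0t := lt_le_trans t0T Tt; have tp := lt_trans t00 t0t.
    rewrite ger0_norm ?sqrtr_ge0// ler_pdivlMr//.
    apply: sqr_boundW; rewrite exprMn sqr_sqrtr ?addr_ge0 ?sqr_ge0// mulrC.
    apply: (le_trans (speed_le (ltW t0t))).
    by rewrite ler_wpM2l ?C2_ge0// EK.
  + apply: (@eqO_pinfty R _ _ K' (Num.max T T')) => t.
    rewrite ge_max => /andP[Tt T't].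
    by rewrite normr_id ler_pdivlMr ?scale// mulrC zK.
  + apply: (@eqO_pinfty R _ _ (2 * K + `|ls| * K') (Num.max T T')) => t.
    rewrite ge_max => /andP[Tt T't].
    rewrite normr_id ler_pdivlMr ?scale// mulrC.
    have H1 := gapK t Tt; have H2 := zK t T't.
    have H3 := aug_gap_ge rho (y t) sp; rewrite -/(gap t) in H3.
    have E := aug_gapE f rho (y t) ls (saddle_feasible sp); rewrite -/(gap t) in E.
    have H4 := normr_inner ls (A (y t) - b).
    have g0 := gap_ge0 t.
    (* The difference of the values of f is the gap minus the multiplier term and the penalty. The
       penalty is itself at most the gap, hence the factor 2. *)
    have H5 : `|f (y t) - f xs| <= 2 * gap t + `|ls| * `|A (y t) - b|.
      move: H4 E H3 g0; rewrite !ler_norml => /andP[h1 h2].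
      move: (gap t) => gt E H3 g0.
      have z2 : 0 <= rho / 2 * `|A (y t) - b| ^+ 2.
        by rewrite mulr_ge0 ?sqr_ge0// divr_ge0// ltW.
      by apply/andP; split; lra.
    apply: (le_trans (ler_wpM2l (ltW (scale t Tt)) H5)).
    have := ler_wpM2l (normr_ge0 ls) H2; lra.
- have [K' H] := trajectory_bounded (ltW t0T) EK.
  by exists K' => t t0t; exact: le_trans (prod_norm_le _ _) (H t t0t).
Qed.

(** * Vanishing velocity under the weaker integrability condition *)

Lemma energy_little_o :
  (\int[mu]_(t in `[t0, +oo[) (xi t * eps t / t)%:E < +oo)%E ->
  forall e, 0 < e ->
  exists T, t0 < T /\ forall t, T <= t -> energy t <= e * t ^+ 2.
Proof.
move=> fin e e0.
have [T [k [t0T k0 Hrate]]] := energy_rate_le.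
have tp t : t0 <= t -> 0 < t by exact: lt_le_trans.
have [||P [K HP]] := bounded_primitive _ _ fin.
- apply: within_continuousM.
    by apply: within_continuousM; exact: derivable_from_within_continuous.
  apply: halfline_continuous_within => t /tp tp0.
  exact: is_derive_continuous
    (@is_deriveV R id t 1 1 (lt0r_neq0 tp0) (is_derive_id t 1)).
- move=> t t0t; rewrite divr_ge0 ?(ltW (tp t t0t))// mulr_ge0 ?eps0// ltW// xi0//.
(* The supremum of [P] stands in for its limit: beyond a point [s] where it is nearly attained, [P]
   can grow only a little. *)
have hs : has_sup [set P t | t in `[T, +oo[].
  split; first by exists (P T), T => //=; rewrite in_itv/= lexx.
  exists K => u [t /=]; rewrite in_itv/= andbT => Tt <-.
  by have [_ /andP[]] := HP t (lt_le_trans t0T Tt).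
(* Dividing by [c0 + 1] covers the case c0 = 0, that is, xs = 0. *)
have c1 : 0 < c0 + 1 by rewrite ltr_wpDl// c0_ge0.
have e1 : 0 < e / 2 / (c0 + 1) by rewrite !divr_gt0.
have [u [s Ts us]] := sup_adherent e1 hs; rewrite -us => sup_s.
move: Ts; rewrite /= in_itv/= andbT => Ts.
(* Beyond this time the fixed value [energy s] is at most e / 2 t^2. *)
pose T' := Num.max s (`|energy s| / (e / 2) + 1).
have t0s := lt_le_trans t0T Ts.
have sT' : s <= T' by rewrite /T' le_max lexx.
exists T'; split; first exact: lt_le_trans t0s sT'.
move=> t T't; have st := le_trans sT' T't.
have t0t := lt_le_trans t0s st; have tp0 := tp t (ltW t0t).
have Pt : P t - P s <= e / 2 / (c0 + 1).
  have : P t <= sup [set P t | t in `[T, +oo[].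
    apply: (sup_upper_bound hs); exists t => //=.
    by rewrite in_itv/= (le_trans Ts st).
  by move: sup_s; lra.
(* The end time [t] is frozen while r runs over [s, t]: since r <= t, the source r xi eps is at most
   t^2 (xi eps / r), a constant times P'. *)
have H : energy t - c0 * t ^+ 2 * P t <= energy s - c0 * t ^+ 2 * P s.
  apply: (@is_derive_le0_le R (fun r => energy r - c0 * t ^+ 2 * P r)
    (fun r => energy_rate r - c0 * t ^+ 2 * (xi r * eps r / r)) s t st).
    move=> r /andP[sr _]; have t0r := lt_le_trans t0s sr.
    have [DP _] := HP r t0r.
    exact: is_deriveB (is_derive_energy t0r) (is_deriveZ (c0 * t ^+ 2) DP).
  move=> r /andP[sr rt]; have t0r := lt_le_trans t0s sr; have rp := tp r (ltW t0r).
  have d0 : 0 <= k * dissipated r.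
    have [d1 d2 d3 d4] := dissipated_terms (ltW t0r).
    by apply: mulr_ge0; [exact: ltW|rewrite /dissipated; do 3 ?[apply: addr_ge0]].
  have := Hrate r (le_trans Ts sr); rewrite -/c0 => Hr.
  have pr : 0 <= xi r * eps r / r.
    by rewrite divr_ge0 ?(ltW rp)// mulr_ge0 ?eps0 ?(ltW t0r)// ltW// xi0// ltW.
  have : r * xi r * eps r <= t ^+ 2 * (xi r * eps r / r).
    have -> : r * xi r * eps r = r ^+ 2 * (xi r * eps r / r).
      by field; rewrite lt0r_neq0.
    by rewrite ler_wpM2r// ler_sqr ?nnegrE// ltW.
  move/(ler_wpM2l c0_ge0); lra.
have t1 : `|energy s| / (e / 2) + 1 <= t.
  by apply: le_trans T't; rewrite /T' le_max lexx orbT.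
have es : energy s <= e / 2 * t ^+ 2.
  apply: (le_trans (ler_norm _)).
  have q0 : 0 <= `|energy s| / (e / 2) by rewrite !divr_ge0// ltW.
  rewrite mulrC -ler_pdivrMr; last by rewrite divr_gt0.
  rewrite expr2; apply: (@le_trans _ _ (t * 1)); first by rewrite mulr1; lra.
  by rewrite ler_wpM2l ?(ltW tp0)//; lra.
have cP : c0 * (P t - P s) <= e / 2.
  apply: (@le_trans _ _ ((c0 + 1) * (e / 2 / (c0 + 1)))); last first.
    by rewrite mulrC divfK// lt0r_neq0.
  apply: (@le_trans _ _ (c0 * (e / 2 / (c0 + 1)))); first by rewrite ler_wpM2l ?c0_ge0.
  by rewrite ler_wpM2r ?(ltW e1)// lerDl.
have := ler_wpM2l (sqr_ge0 t) cP; lra.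
Qed.

(** By [speed_le] the squared speed is at most C2 energy / t^2, which [energy_little_o] sends to
    0. *)
Lemma velocity_vanishes :
  (\int[mu]_(t in `[t0, +oo[) (xi t * eps t / t)%:E < +oo)%E ->
  (dx t, dl t) @[t --> +oo] --> ((0, 0) : X * Y).
Proof.
move=> fin.
have small e : 0 < e ->
    exists T, forall t, T <= t -> `|dx t| ^+ 2 + `|dl t| ^+ 2 <= e ^+ 2.
  move=> e0; have c1 : 0 < C2 + 1 by rewrite ltr_wpDl// C2_ge0.
  have e1 : 0 < e ^+ 2 / (C2 + 1) by rewrite divr_gt0// exprn_gt0.
  have [T [t0T HT]] := energy_little_o fin e1.
  exists T => t Tt; have t0t := lt_le_trans t0T Tt; have tp := lt_trans t00 t0t.
  have t2 : 0 < t ^+ 2 by rewrite exprn_gt0.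
  rewrite -(ler_pM2l t2); apply: (le_trans (speed_le (ltW t0t))).
  apply: (le_trans (ler_wpM2l C2_ge0 (HT t Tt))).
  rewrite mulrA mulrC ler_wpM2l ?(ltW t2)//.
  by rewrite [C2 * _]mulrC mulrAC ler_pdivrMr// ler_wpM2l ?sqr_ge0// lerDl.
apply: cvg_pair => /=; apply/cvgr0Pnorm_le => e e0;
  have [T HT] := small e e0; near=> t.
- have Tt : T <= t by near: t; apply: nbhs_pinfty_ge; exact: num_real.
  rewrite -ler_sqr ?nnegrE ?(ltW e0)//; apply: le_trans (HT t Tt).
  by rewrite lerDl sqr_ge0.
- have Tt : T <= t by near: t; apply: nbhs_pinfty_ge; exact: num_real.
  rewrite -ler_sqr ?nnegrE ?(ltW e0)//; apply: le_trans (HT t Tt).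
  by rewrite lerDr sqr_ge0.
Unshelve. all: by end_near. Qed.

End trajectory.

Theorem theorem2 (R : realType) (X Y : hilbertType R)
  (f : X -> R) (gradf : X -> X) (A : {linear X -> Y}) (AT : Y -> X) (b : Y)
  (rho alpha gamma beta t0 : R) (xi eps : R -> R)
  (x : R -> X) (l : R -> Y) (xs : X) (ls : Y) :
  convex_function [set: X] f ->
  is_gradient f gradf -> continuous gradf ->
  continuous A -> is_adjoint A AT ->
  0 < rho -> 0 < t0 -> 3 < alpha ->
  (0 < gamma \/ gamma = 0 /\ 0 <= beta) ->
  (forall t, t0 <= t -> 0 < xi t) -> derivable_from t0 xi ->
  (exists t1 delta, [/\ t0 <= t1, 0 < delta &
    forall t, t1 <= t ->
      (2 - 2 * alpha / 3) + t * (derive_from t0 xi t / xi t) < - delta]) ->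
  (forall t, t0 <= t -> 0 <= eps t) -> C1_from t0 eps ->
  (forall s t, t0 <= s -> s <= t -> eps t <= eps s) ->
  eps t @[t --> +oo] --> 0 ->
  (exists M t1, [/\ 1 < M, t0 <= t1 &
    forall t, t1 <= t ->
      2 * derive_from t0 eps t
      + M * `|betaf gamma beta t| * xi t * eps t ^+ 2 <= 0]) ->
  solution rho alpha gamma beta t0 gradf A AT b xi eps x l ->
  saddle_points f A b (xs, ls) ->
  let mu := @lebesgue_measure R in
  let dx := derive_from t0 x in
  let dl := derive_from t0 l in
  let xhat := hat t0 gamma beta x in
  let gap t := aug_lagrangian rho f A b (xhat t) ls
               - aug_lagrangian rho f A b xs ls in
  ((\int[mu]_(t in `[t0, +oo[) (t * xi t * eps t)%:E < +oo)%E ->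
   t ^+ 2 * xi t @[t --> +oo] --> +oo ->
   (exists K, forall t, t0 <= t -> prod_norm (x t) (l t) <= K) /\
   (exists2 t2, t0 <= t2 &
     [/\ (\int[mu]_(t in `[t2, +oo[) (t * xi t * gap t)%:E < +oo)%E,
         (\int[mu]_(t in `[t2, +oo[)
            (t * xi t * eps t * `|x t| ^+ 2)%:E < +oo)%E,
         (\int[mu]_(t in `[t2, +oo[)
            (t * (`|dx t| ^+ 2 + `|dl t| ^+ 2))%:E < +oo)%E &
         (\int[mu]_(t in `[t2, +oo[)
            (t * xi t * `|A (xhat t) - b| ^+ 2)%:E < +oo)%E]) /\
   [/\ gap =O_ (pinfty_nbhs R) (fun t => (t ^+ 2 * xi t)^-1),
       (fun t => prod_norm (dx t) (dl t)) =O_ (pinfty_nbhs R) (fun t => t^-1),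
       (fun t => `|A (xhat t) - b|) =O_ (pinfty_nbhs R)
         (fun t => (t ^+ 2 * xi t)^-1) &
       (fun t => `|f (xhat t) - f xs|) =O_ (pinfty_nbhs R)
         (fun t => (t ^+ 2 * xi t)^-1)])
  /\
  ((\int[mu]_(t in `[t0, +oo[) (xi t * eps t / t)%:E < +oo)%E ->
   (dx t, dl t) @[t --> +oo] --> ((0, 0) : X * Y)).
Proof.
move=> cf gf _ cA adj rho0 t00 alpha3 gb xi0 Dxi xi_growth eps0 [Deps _] _ _.
move=> eps_decay sol sp mu dx dl xhat gap; split.
  move=> fin _.
  exact: (convergence_rates cf gf cA adj rho0 t00 alpha3 gb xi0 Dxi eps0 Deps
    sol sp xi_growth eps_decay fin).
exact: (velocity_vanishes cf gf cA adj rho0 t00 alpha3 gb xi0 Dxi eps0 Deps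
  sol sp xi_growth eps_decay).
Qed.
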